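(* Let $d\in\mathbb{N}$ and let $f_n,f\in D[0,1]$ ($n\in\mathbb{N}$). Write $f_n\xrightarrow{\mathcal{T}}f$ for $d_{\mathcal{T}}(f_n,f)\to0$, $\mathcal{T}\in\{J_1,J_2,M_1,M_2\}$. Then: $f_n\xrightarrow{J_1}f$ implies $f_n\xrightarrow{J_2}f$ and implies $f_n\xrightarrow{M_1}f$; each of $f_n\xrightarrow{J_2}f$ and $f_n\xrightarrow{M_1}f$ implies $f_n\xrightarrow{M_2}f$; and $$f_n\xrightarrow{J_1}f\quad\Longleftrightarrow\quad f_n\xrightarrow{M_1}f\ \text{ and }\ f_n\xrightarrow{J_2}f.$$
   Context: $[[x,y]]=\{\alpha x+(1-\alpha)y:\alpha\in[0,1]\}$ for $x,y\in\mathbb{R}^d$, and $\|\cdot\|_\infty$ is the supremum norm. $D[0,1]$ is the set of functions $f:[0,1]\to\mathbb{R}^d$ that are right continuous with left limits and left continuous at $1$; $f(t-)$ is the left limit, with $f(0-):=f(0)$. Metrics on $D[0,1]$. Let $\Gamma_f=\{(z,t)\in\mathbb{R}^d\times[0,1]: z=f(t-)\text{ or }z=f(t)\}$ (incomplete graph) and $\overline{\Gamma_f}=\{(z,t)\in\mathbb{R}^d\times[0,1]: z\in[[f(t-),f(t)]]\}$ (complete graph). Order $\overline{\Gamma_f}$ by $(z_1,t_1)\le(z_2,t_2)$ if $t_1<t_2$, or $t_1=t_2$ and $|f(t_1-)-z_1|\le|f(t_2-)-z_2|$. Let $\pi(\overline{\Gamma_f})$ be the set of pairs $(u,r)$ with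 $u:[0,1]\to\mathbb{R}^d$ and $r:[0,1]\to[0,1]$ continuous, $(u,r)$ non-decreasing for this order, and $(u,r)([0,1])=\overline{\Gamma_f}$. Let $\Lambda_c$ be the set of continuous bijections of $[0,1]$. For $A,B\subset\mathbb{R}^d\times[0,1]$ let $m_H(A,B)=\inf\{\varepsilon>0:A\subset B^\varepsilon,\ B\subset A^\varepsilon\}$ with $B^\varepsilon=\{(x,t)\in\mathbb{R}^d\times[0,1]:\exists (y,s)\in B,\ |x-y|\vee|t-s|\le\varepsilon\}$. Then $d_{J_1}(f_1,f_2)=\inf_{\lambda\in\Lambda_c}\{\|f_1\circ\lambda-f_2\|_\infty\vee\|\lambda-\mathrm{id}\|_\infty\}$, $d_{M_1}(f_1,f_2)=\inf\{\|u_1-u_2\|_\infty\vee\|r_1-r_2\|_\infty:(u_j,r_j)\in\pi(\overline{\Gamma_{f_j}}),\ j=1,2\}$, $d_{J_2}(f_1,f_2)=m_H(\Gamma_{f_1},\Gamma_{f_2})$, $d_{M_2}(f_1,f_2)=m_H(\overline{\Gamma_{f_1}},\overline{\Gamma_{f_2}})$. *)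

(* Defs.v *)
(* MathComp-Analysis *)
From HB Require Import structures.
From mathcomp Require Import all_boot all_order all_algebra.
From mathcomp Require Import all_classical all_reals all_analysis.

Set Implicit Arguments.
Unset Strict Implicit.
Unset Printing Implicit Defensive.

Import Order.TTheory GRing.Theory Num.Theory.
Import numFieldTopology.Exports numFieldNormedType.Exports.

Local Open Scope classical_set_scope.
Local Open Scope ring_scope.

(* A function on [0, 1] is encoded as a total function on R, all of whose
   values outside [0, 1] are ignored: inside (0, 1), at 0 from the right and at
   1 from the left, the one-sided filters are eventually contained in [0, 1].
   The library norm on 'rV[R]_d is the max norm; it is used for the topology
   only, and |.| on R^d is the Euclidean norm [enorm].
   Suprema and distances are extended reals, so that the infimum of the empty
   set is +oo (and not the default value 0 of [inf] on R). *)

Section Skorokhod.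
Context {R : realType} {d : nat}.
Implicit Types (f g u : R -> 'rV[R]_d) (r l : R -> R) (x y z : 'rV[R]_d).
Implicit Types (p q : 'rV[R]_d * R) (A B : set ('rV[R]_d * R)).

Definition I01 : set R := `[0, 1].

Definition enorm x : R := Num.sqrt (\sum_(i < d) x ord0 i ^+ 2).

Definition segm x y : set 'rV[R]_d :=
  [set a *: x + (1 - a) *: y | a in I01].

Definition sup01 (h : R -> R) : \bar R := ereal_sup [set (h t)%:E | t in I01].

Definition cadlag01 f : Prop :=
  [/\ forall t : R, 0 <= t < 1 -> f x @[x --> t^'+] --> f t,
      forall t : R, 0 < t <= 1 -> cvg (f x @[x --> t^'-])
    & f x @[x --> 1^'-] --> f 1].

Definition left_val f (t : R) : 'rV[R]_d :=
  if t == 0 then f 0 else lim (f x @[x --> t^'-]).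

Definition graph f : set ('rV[R]_d * R) :=
  [set p | I01 p.2 /\ (p.1 = left_val f p.2 \/ p.1 = f p.2)].

Definition complete_graph f : set ('rV[R]_d * R) :=
  [set p | I01 p.2 /\ segm (left_val f p.2) (f p.2) p.1].

Definition graph_le f p q : Prop :=
  p.2 < q.2 \/
  (p.2 = q.2 /\
   enorm (left_val f p.2 - p.1) <= enorm (left_val f q.2 - q.1)).

Definition parametrization f u r : Prop :=
  [/\ {within I01, continuous u},
      {within I01, continuous r},
      {homo r : t / I01 t},
      forall s t, I01 s -> I01 t -> s <= t ->
        graph_le f (u s, r s) (u t, r t)
    & [set (u t, r t) | t in I01] = complete_graph f].

(* Monotonicity is not required: decreasing bijections are included. *)
Definition time_change l : Prop :=
  {within I01, continuous l} /\ set_bij I01 I01 l.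

Definition thicken B (e : R) : set ('rV[R]_d * R) :=
  [set p | I01 p.2 /\
    exists2 q, B q & Num.max (enorm (p.1 - q.1)) `|p.2 - q.2| <= e].

Definition hausdorff A B : \bar R :=
  ereal_inf [set e%:E | e in
    [set e : R | [/\ 0 < e, A `<=` thicken B e & B `<=` thicken A e]]].

Definition dJ1 f g : \bar R :=
  ereal_inf [set maxe (sup01 (fun t => enorm (f (l t) - g t)))
                      (sup01 (fun t => `|l t - t|)) | l in time_change].

Definition dM1 f g : \bar R :=
  ereal_inf [set c | exists u1 r1 u2 r2,
    [/\ parametrization f u1 r1, parametrization g u2 r2
      & c = maxe (sup01 (fun t => enorm (u1 t - u2 t)))
                 (sup01 (fun t => `|r1 t - r2 t|))]].

Definition dJ2 f g : \bar R := hausdorff (graph f) (graph g).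

Definition dM2 f g : \bar R :=
  hausdorff (complete_graph f) (complete_graph g).

Definition cvg_for (dist : (R -> 'rV[R]_d) -> (R -> 'rV[R]_d) -> \bar R)
    (fn : nat -> R -> 'rV[R]_d) f : Prop :=
  dist (fn n) f @[n --> \oo] --> 0%E.

End Skorokhod.

(* Main.v *)
Require Import Defs.
From mathcomp Require Import all_boot all_order all_algebra.
From mathcomp Require Import all_classical all_reals all_analysis.
From mathcomp Require Import ring lra.

(** Let [fn] converge to [f].

    [J1] implies the other three. If [l] is a time change with [fn \o l]
    uniformly close to [f], then the left limits are close too
    ([left_val_close]), so the points of the two incomplete graphs correspond
    through [l]; this is [J2] ([cvg_J1_J2]). For [M1] one needs parametrizations
    of both complete graphs: there is a continuous non-decreasing clock [r] that
    rests at each of the countably many jump times of [f] and of [fn \o l]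
    ([resting_clock_exists]), and during a rest both jumps are swept linearly
    with the same weights, so that the parametrizations stay as close as [f] and
    [fn \o l] ([cvg_J1_M1]).

    [M1] implies [M2] because a parametrization has the whole complete graph as
    its image ([cvg_M1_M2]).

    The two remaining implications are local in time. Given [eta > 0], each
    time [t] has a neighbourhood in which the graph of [f] is made of one cluster
    of radius [eta] around the left limit [A] of [f] at [t], for earlier times,
    and of another one around [B = f t], for later times ([cadlag_clustered]).
    By a compactness argument ([interval_induction]) it suffices to work in
    finitely many such neighbourhoods. If [fn] is [J2]-close to [f], its values
    there all lie near [A] or near [B]. When [A] and [B] are far apart, [fn] is
    near [A] at first and near [B] in the end, hence it jumps from one to the
    other at the last time [c] at which it is near [A] ([crossing]).
    This jump accounts for the segment joining [A] to [B] in the complete graph,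
    which gives [M2] ([cvg_J2_M2]). [J2] alone does not prevent [fn] from
    oscillating between [A] and [B] before [c], but [M1] does: a
    parametrization of the complete graph of [f] goes monotonically from [A] to
    [B], and a close parametrization for [fn] cannot come back from [B] to [A]
    ([no_return]). Therefore [fn] is near [A] before [c] and near [B] after [c],
    the piecewise linear time change sending [t] to [c] makes [fn] uniformly
    close to [f] near [t], and these time changes are glued
    ([cvg_M1_J2_J1]). *)

Set Implicit Arguments.
Unset Strict Implicit.
Unset Printing Implicit Defensive.

Import Order.TTheory GRing.Theory Num.Theory.
Import numFieldTopology.Exports numFieldNormedType.Exports.

Local Open Scope classical_set_scope.
Local Open Scope ring_scope.

(** * The Euclidean norm and segments *)


Lemma I01E {R : realType} (t : R) : I01 t = (0 <= t <= 1) :> Prop.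
Proof. by rewrite /I01/= in_itv. Qed.

Section Euclid.
Context {R : realType} {d : nat}.
Implicit Types (x y z : 'rV[R]_d) (a b e : R).

Lemma enorm_ge0 x : 0 <= enorm x.
Proof. exact: sqrtr_ge0. Qed.

Lemma enorm_sqr x : enorm x ^+ 2 = \sum_(i < d) x ord0 i ^+ 2.
Proof. by rewrite sqr_sqrtr// sumr_ge0// => i _; exact: sqr_ge0. Qed.

Lemma enorm_ge_coord x i : `|x ord0 i| <= enorm x.
Proof.
rewrite -(@ler_pXn2r _ 2)// ?nnegrE ?enorm_ge0// enorm_sqr real_normK ?num_real//.
by rewrite (bigD1 i)//= lerDl sumr_ge0// => j _; exact: sqr_ge0.
Qed.

Lemma enorm0_eq0 x : enorm x = 0 -> x = 0.
Proof.
move=> x0; apply/rowP => i; rewrite mxE; apply/eqP.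
by rewrite -normr_le0 -x0 enorm_ge_coord.
Qed.

Lemma enormZ a x : enorm (a *: x) = `|a| * enorm x.
Proof.
rewrite /enorm -sqrtr_sqr -sqrtrM ?sqr_ge0// mulr_sumr.
by congr Num.sqrt; apply: eq_bigr => i _; rewrite mxE exprMn.
Qed.

Lemma enorm0 : enorm (0 : 'rV[R]_d) = 0.
Proof. by rewrite -(scale0r 0) enormZ normr0 mul0r. Qed.

Lemma enormN x : enorm (- x) = enorm x.
Proof. by rewrite -scaleN1r enormZ normrN1 mul1r. Qed.

Lemma enormB x y : enorm (x - y) = enorm (y - x).
Proof. by rewrite -enormN opprB. Qed.

(** With [p] and [q] the two norms, [2 x_i y_i <= (q/p) x_i^2 + (p/q) y_i^2]
    termwise; summing gives Minkowski's inequality without going through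
    Cauchy-Schwarz. *)
Lemma enormD x y : enorm (x + y) <= enorm x + enorm y.
Proof.
have [/eqP/enorm0_eq0 ->|x0] := boolP (enorm x == 0).
  by rewrite add0r lerDr enorm_ge0.
have [/eqP/enorm0_eq0 ->|y0] := boolP (enorm y == 0).
  by rewrite addr0 lerDl enorm_ge0.
set p := enorm x; set q := enorm y.
have p0 : 0 < p by rewrite lt_neqAle eq_sym x0 enorm_ge0.
have q0 : 0 < q by rewrite lt_neqAle eq_sym y0 enorm_ge0.
rewrite -(@ler_pXn2r _ 2)// ?nnegrE ?enorm_ge0 ?addr_ge0 ?enorm_ge0//.
rewrite enorm_sqr.
have -> : (p + q) ^+ 2 =
    \sum_(i < d) ((1 + q / p) * x ord0 i ^+ 2 + (1 + p / q) * y ord0 i ^+ 2).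
  rewrite big_split/= -!mulr_sumr -!enorm_sqr -/p -/q.
  by field; rewrite !gt_eqF.
apply: ler_sum => i _; rewrite mxE.
set u := x _ _; set v := y _ _.
rewrite -subr_ge0.
have -> : (1 + q / p) * u ^+ 2 + (1 + p / q) * v ^+ 2 - (u + v) ^+ 2 =
   (q * u - p * v) ^+ 2 / (p * q).
  by field; rewrite !gt_eqF.
by rewrite divr_ge0 ?sqr_ge0// ltW// mulr_gt0.
Qed.

Lemma enorm_triangle y x z : enorm (x - z) <= enorm (x - y) + enorm (y - z).
Proof. by rewrite (le_trans _ (enormD _ _))// addrA subrK. Qed.

Lemma le_norm_enorm x : `|x| <= enorm x.
Proof.
have -> : `|x| = mx_norm x by [].
have [->|/mx_norm_neq0 [[i j] ->]] := eqVneq (mx_norm x) 0.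
  exact: enorm_ge0.
by rewrite /= (ord1 i) enorm_ge_coord.
Qed.

Lemma le_enorm_norm x : enorm x <= Num.sqrt d%:R * `|x|.
Proof.
rewrite -[X in _ * X](ger0_norm (normr_ge0 x)) -sqrtr_sqr -sqrtrM ?ler0n//.
rewrite ler_wsqrtr//.
have -> : d%:R * `|x| ^+ 2 = \sum_(i < d) `|x| ^+ 2.
  by rewrite sumr_const card_ord mulr_natl.
apply: ler_sum => i _.
rewrite -[leLHS]real_normK ?num_real// ler_pXn2r// ?nnegrE ?normr_ge0//.
have -> : `|x| = mx_norm x by [].
rewrite mx_normrE (le_trans _ (le_bigmax _ _ (ord0, i)))//.
Qed.

Lemma cvg_enormP {T : Type} {F : set_system T} {FF : Filter F}
    (h : T -> 'rV[R]_d) x :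
  h t @[t --> F] --> x <->
  forall e, 0 < e -> \forall t \near F, enorm (h t - x) < e.
Proof.
split=> [/cvgrPdist_lt hx e e0|hx].
  have s0 : 0 < Num.sqrt d%:R + 1 :> R by rewrite ltr_wpDl ?sqrtr_ge0.
  near=> t.
  rewrite enormB (le_lt_trans (le_enorm_norm _))//.
  rewrite (@le_lt_trans _ _ ((Num.sqrt d%:R + 1) * `|x - h t|))//.
    by rewrite ler_wpM2r// lerDl.
  by rewrite mulrC -ltr_pdivlMr//; near: t; apply: hx; rewrite divr_gt0.
apply/cvgrPdist_lt => e e0; near=> t.
rewrite distrC (le_lt_trans (le_norm_enorm _))//.
by near: t; exact: hx.
Unshelve. all: by end_near. Qed.

Lemma enorm_conv a x y x' y' e : 0 <= a <= 1 ->
  enorm (x - x') <= e -> enorm (y - y') <= e ->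
  enorm (a *: x + (1 - a) *: y - (a *: x' + (1 - a) *: y')) <= e.
Proof.
move=> /andP[a0 a1] xx' yy'.
have -> : a *: x + (1 - a) *: y - (a *: x' + (1 - a) *: y') =
    a *: (x - x') + (1 - a) *: (y - y').
  by rewrite !scalerBr opprD addrACA.
rewrite (le_trans (enormD _ _))// !enormZ !ger0_norm ?subr_ge0//.
have b0 : 0 <= 1 - a by rewrite subr_ge0.
have := ler_wpM2l a0 xx'; have := ler_wpM2l b0 yy'; lra.
Qed.

Lemma convxx a x : a *: x + (1 - a) *: x = x.
Proof. by rewrite -scalerDl addrC subrK scale1r. Qed.

Lemma segm_l x y : segm x y x.
Proof.
by exists 1; rewrite ?I01E ?ler01 ?lexx// subrr scale0r addr0 scale1r.
Qed.

Lemma segm_r x y : segm x y y.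
Proof.
by exists 0; rewrite ?I01E ?ler01 ?lexx// subr0 scale0r add0r scale1r.
Qed.

Lemma segm_near x y x' y' z e :
  enorm (x - x') <= e -> enorm (y - y') <= e -> segm x y z ->
  exists2 z', segm x' y' z' & enorm (z - z') <= e.
Proof.
move=> xx yy [a aI <-]; exists (a *: x' + (1 - a) *: y'); first by exists a.
by apply: enorm_conv; rewrite -?I01E.
Qed.

Lemma segm_ball x y z c e :
  enorm (x - c) <= e -> enorm (y - c) <= e -> segm x y z -> enorm (z - c) <= e.
Proof.
move=> xc yc /(segm_near xc yc)[z' [a _ <-]]; by rewrite convxx.
Qed.

Lemma segmC x y z : segm x y z -> segm y x z.
Proof.
move=> [a aI <-]; exists (1 - a); last by rewrite opprB addrC subrKC addrC.
by move: aI; rewrite !I01E => /andP[a0 a1]; apply/andP; split; lra.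
Qed.

End Euclid.

(** * One-sided limits of right continuous functions with left limits *)


Section Cadlag.
Context {R : realType} {d : nat}.
Implicit Types (f g : R -> 'rV[R]_d) (x y z l c : 'rV[R]_d) (s t e : R).

Lemma at_rightP t (P : R -> Prop) : (\forall s \near t^'+, P s) <->
  exists2 del, 0 < del & forall s, t < s < t + del -> P s.
Proof.
split=> [/nbhs_ballP[del /= del0 h]|[del del0 h]].
  exists del => // s /andP[ts st]; apply: h => //.
  by rewrite /ball/= ltr_distlC; apply/andP; split; lra.
near=> s; apply: h; apply/andP; split; first by near: s; exact: nbhs_right_gt.
by near: s; apply: nbhs_right_lt; lra.
Unshelve. all: by end_near. Qed.

Lemma at_leftP t (P : R -> Prop) : (\forall s \near t^'-, P s) <->
  exists2 del, 0 < del & forall s, t - del < s < t -> P s.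
Proof.
split=> [/nbhs_ballP[del /= del0 h]|[del del0 h]].
  exists del => // s /andP[ts st]; apply: h => //.
  by rewrite /ball/= ltr_distlC; apply/andP; split; lra.
near=> s; apply: h; apply/andP; split; last by near: s; exact: nbhs_left_lt.
by near: s; apply: nbhs_left_gt; lra.
Unshelve. all: by end_near. Qed.

Lemma left_val0 f : left_val f 0 = f 0.
Proof. by rewrite /left_val eqxx. Qed.

Lemma left_val1 f : cadlag01 f -> left_val f 1 = f 1.
Proof.
case=> _ _ h; rewrite /left_val oner_eq0.
exact: (cvg_lim (@norm_hausdorff _ _)).
Qed.

Lemma cadlag_right f t e : cadlag01 f -> 0 <= t < 1 -> 0 < e ->
  exists2 del, 0 < del & forall s, t <= s < t + del -> enorm (f s - f t) < e.
Proof.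
move=> [hr _ _] tI e0; have /cvg_enormP/(_ e e0)/at_rightP[del del0 h] := hr t tI.
exists del => // s /andP[]; rewrite le_eqVlt => /predU1P[<- _|ts st].
  by rewrite subrr enorm0.
by apply: h; rewrite ts.
Qed.

Lemma cadlag_left f t e : cadlag01 f -> 0 < t <= 1 -> 0 < e ->
  exists2 del, 0 < del &
    forall s, t - del < s < t -> enorm (f s - left_val f t) < e.
Proof.
move=> [_ hl _] tI e0; have /(_ tI) := hl t; rewrite /left_val.
have /gt_eqF -> : 0 < t by case/andP: tI.
by move=> /cvg_enormP/(_ e e0)/at_leftP.
Qed.

Lemma left_val_ball f t c e : cadlag01 f -> 0 < t <= 1 ->
  (forall del, 0 < del -> exists2 s, t - del < s < t & enorm (f s - c) <= e) ->
  enorm (left_val f t - c) <= e.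
Proof.
move=> hf tI h; apply/ler_addgt0Pl => k k0.
have [del del0 hd] := cadlag_left hf tI k0.
have [s sI sc] := h del del0.
rewrite (le_trans (enorm_triangle (f s) _ _))// lerD//.
by rewrite enormB ltW// hd.
Qed.

Lemma right_val_ball f t c e : cadlag01 f -> 0 <= t < 1 ->
  (forall del, 0 < del -> exists2 s, t < s < t + del & enorm (f s - c) <= e) ->
  enorm (f t - c) <= e.
Proof.
move=> hf tI h; apply/ler_addgt0Pl => k k0.
have [del del0 hd] := cadlag_right hf tI k0.
have [s /andP[ts st] sc] := h del del0.
rewrite (le_trans (enorm_triangle (f s) _ _))// lerD//.
by rewrite enormB ltW// hd// ltW.
Qed.

Lemma graph_complete f : graph f `<=` complete_graph f.
Proof.
move=> [z s] [sI zs]; split=> //.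
by case: zs => /= ->; [exact: segm_l|exact: segm_r].
Qed.

Lemma graph_val f t : 0 <= t <= 1 -> graph f (f t, t).
Proof. by move=> tI; split; [rewrite I01E|right]. Qed.

Lemma graph_left f t : 0 <= t <= 1 -> graph f (left_val f t, t).
Proof. by move=> tI; split; [rewrite I01E|left]. Qed.

(** The completed graph of [f] over the window [(t - del, t + del)] consists of
    one cluster on each side of [t] and of the segment joining their centres. *)
Definition clustered f t eta del : Prop := forall z s,
  complete_graph f (z, s) -> t - del < s < t + del ->
  [/\ s < t -> enorm (z - left_val f t) <= eta,
      t < s -> enorm (z - f t) <= eta
    & s = t -> segm (left_val f t) (f t) z].

(** The left values [left_val f s] in the window inherit the bounds on the values
    of [f], being limits of those, and segments stay in balls. *)
Lemma cadlag_clustered f t eta : cadlag01 f -> 0 <= t <= 1 -> 0 < eta ->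
  exists2 del, 0 < del & clustered f t eta del.
Proof.
move=> hf /andP[t0 t1] eta0.
have [d1 d10 h1] : exists2 d1, 0 < d1 & forall s, 0 <= s -> t - d1 < s < t ->
    enorm (f s - left_val f t) < eta.
  move: t0; rewrite le_eqVlt => /predU1P[<-|t0].
    by exists 1 => // s s0 /andP[_]; rewrite ltNge s0.
  have [|d1 d10 h] := cadlag_left hf _ eta0 (t := t); first by rewrite t0.
  by exists d1 => // s _; exact: h.
have [d2 d20 h2] : exists2 d2, 0 < d2 & forall s, s <= 1 -> t < s < t + d2 ->
    enorm (f s - f t) < eta.
  move: t1; rewrite le_eqVlt => /predU1P[->|t1].
    by exists 1 => // s s1 /andP[]; rewrite ltNge s1.
  have [|d2 d20 h] := cadlag_right hf _ eta0 (t := t); first by rewrite t0.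
  by exists d2 => // s _ /andP[ts st]; apply: h; rewrite ltW.
have cl1 s : 0 <= s -> s <= 1 -> t - d1 < s < t ->
    enorm (left_val f s - left_val f t) <= eta.
  rewrite le_eqVlt => /predU1P[<-|s0] s1 /andP[ds st].
    by rewrite left_val0 ltW// h1// ds.
  apply: left_val_ball => //; first by rewrite s0.
  move=> k k0; pose m := Num.max (Num.max (t - d1) 0) (s - k).
  have ms : m < s by rewrite !gt_max ds s0/= ltrBlDr ltrDl.
  have [mt m0 mk] : [/\ t - d1 <= m, 0 <= m & s - k <= m].
    by rewrite /m !le_max !lexx !orbT.
  exists ((m + s) / 2); first by apply/andP; split; lra.
  by rewrite ltW// h1//; [lra|apply/andP; split; lra].
have cl2 s : 0 <= s -> s <= 1 -> t < s < t + d2 ->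
    enorm (left_val f s - f t) <= eta.
  move=> s0 s1 /andP[ts st].
  apply: left_val_ball => //; first by rewrite s1 (le_lt_trans t0).
  move=> k k0; pose m := Num.max t (s - k).
  have ms : m < s by rewrite gt_max ts/= ltrBlDr ltrDl.
  have [mt mk] : t <= m /\ s - k <= m by rewrite /m !le_max !lexx !orbT.
  exists ((m + s) / 2); first by apply/andP; split; lra.
  by rewrite ltW// h2//; [lra|apply/andP; split; lra].
exists (Num.min d1 d2); first by rewrite lt_min d10.
move=> z s [/=]; rewrite I01E => /andP[s0 s1] zs /andP[ds sd].
have [m1 m2] : Num.min d1 d2 <= d1 /\ Num.min d1 d2 <= d2.
  by rewrite !ge_min !lexx !orbT.
split=> [st|ts|<-//].
- apply: (segm_ball _ _ zs); first by apply: cl1 => //; apply/andP; split; lra.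
  by apply/ltW/h1 => //; apply/andP; split; lra.
- apply: (segm_ball _ _ zs); first by apply: cl2 => //; apply/andP; split; lra.
  by apply/ltW/h2 => //; apply/andP; split; lra.
Qed.

End Cadlag.

(** * Convergence for the four distances in terms of witnesses *)


Section Distances.
Context {R : realType} {d : nat}.
Implicit Types (f g u : R -> 'rV[R]_d) (r l : R -> R).
Implicit Types (A B : set ('rV[R]_d * R)) (e : R).

Definition J1_close f g e : Prop := exists2 l, time_change l &
  forall t, I01 t -> enorm (f (l t) - g t) <= e /\ `|l t - t| <= e.

Definition M1_close f g e : Prop := exists u1 r1 u2 r2,
  [/\ parametrization f u1 r1, parametrization g u2 r2
    & forall t, I01 t -> enorm (u1 t - u2 t) <= e /\ `|r1 t - r2 t| <= e].

Definition hausdorff_close A B e : Prop :=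
  A `<=` thicken B e /\ B `<=` thicken A e.

Lemma thickenP A e z s : thicken A e (z, s) <->
  I01 s /\ exists z' s', [/\ A (z', s'), enorm (z - z') <= e & `|s - s'| <= e].
Proof.
split=> [[sI [[z' s'] Aq]]|[sI [z' [s' [Aq h1 h2]]]]].
  by rewrite ge_max => /andP[h1 h2]; split=> //; exists z', s'.
by split=> //; exists (z', s') => //; rewrite ge_max h1.
Qed.

(** Every distance of interest is a nonnegative infimum over witnesses, so its
    convergence to 0 is the eventual existence of arbitrarily good witnesses. *)
Lemma cvg_witnessP (w : nat -> \bar R) (W : nat -> R -> Prop) :
  (forall n, 0 <= w n)%E ->
  (forall n e, 0 < e -> W n e -> (w n <= e%:E)%E) ->
  (forall n e, (w n < e%:E)%E -> W n e) ->
  w n @[n --> \oo] --> 0%E <->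
  forall e, 0 < e -> \forall n \near \oo, W n e.
Proof.
move=> w0 Ww wW; split=> [/fine_cvgP[wfin /cvgrPdist_lt h] e e0|h].
  near=> n; apply: wW.
  have wn : w n \is a fin_num by near: n.
  rewrite -(fineK wn) lte_fin (le_lt_trans (ler_norm _))//.
  by rewrite -normrN -[X in `|X|]add0r; near: n; exact: h.
apply/fine_cvgP; split.
  near=> n; rewrite ge0_fin_numE ?w0//.
  by rewrite (@le_lt_trans _ _ 1%:E) ?ltry// Ww//; near: n; exact: h.
apply/cvgrPdist_le => e e0; near=> n.
rewrite sub0r normrN ger0_norm ?fine_ge0 ?w0//.
have wn : (w n <= e%:E)%E by apply: Ww => //; near: n; exact: h.
by rewrite -lee_fin fineK// ge0_fin_numE ?w0// (le_lt_trans wn) ?ltry.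
Unshelve. all: by end_near. Qed.

Lemma sup01_ge0 (h : R -> R) : (forall t, 0 <= h t) -> (0 <= sup01 h)%E.
Proof.
move=> h0; apply: (@le_trans _ _ (h 0)%:E); first by rewrite lee_fin.
by apply: ereal_sup_ubound; exists 0; rewrite ?I01E ?lexx ?ler01.
Qed.

Lemma sup01_le (h : R -> R) e :
  (forall t, I01 t -> h t <= e) -> (sup01 h <= e%:E)%E.
Proof. by move=> he; apply: ge_ereal_sup => _ [t /he ht <-]; rewrite lee_fin. Qed.

Lemma sup01_lt (h : R -> R) e t :
  (sup01 h < e%:E)%E -> I01 t -> h t <= e.
Proof.
move=> he tI; rewrite -lee_fin; apply/ltW; apply: le_lt_trans he.
by apply: ereal_sup_ubound; exists t.
Qed.

Lemma cvg_J1P (fn : nat -> R -> 'rV[R]_d) f : cvg_for dJ1 fn f <->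
  forall e, 0 < e -> \forall n \near \oo, J1_close (fn n) f e.
Proof.
apply: cvg_witnessP => [n|n e e0 [l lT h]|n e].
- apply: le_ereal_inf_tmp => _ [l _ <-].
  by rewrite le_max sup01_ge0// => t; exact: enorm_ge0.
- apply: (@le_trans _ _
    (maxe (sup01 (fun t => enorm (fn n (l t) - f t)))
          (sup01 (fun t => `|l t - t|)))).
    by apply: ereal_inf_lbound; exists l.
  by rewrite ge_max !sup01_le// => t /h[].
- move=> /ereal_inf_lt[_ [l lT <-]]; rewrite gt_max => /andP[h1 h2].
  by exists l => // t tI; split; [exact: (sup01_lt h1)|exact: (sup01_lt h2)].
Qed.

Lemma cvg_M1P (fn : nat -> R -> 'rV[R]_d) f : cvg_for dM1 fn f <->
  forall e, 0 < e -> \forall n \near \oo, M1_close (fn n) f e.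
Proof.
apply: cvg_witnessP => [n|n e e0 [u1 [r1 [u2 [r2 [p1 p2 h]]]]]|n e].
- apply: le_ereal_inf_tmp => _ [u1 [r1 [u2 [r2 [_ _ ->]]]]].
  by rewrite le_max sup01_ge0// => t; exact: enorm_ge0.
- apply: (@le_trans _ _
    (maxe (sup01 (fun t => enorm (u1 t - u2 t)))
          (sup01 (fun t => `|r1 t - r2 t|)))).
    by apply: ereal_inf_lbound; exists u1, r1, u2, r2.
  by rewrite ge_max !sup01_le// => t /h[].
- move=> /ereal_inf_lt[_ [u1 [r1 [u2 [r2 [p1 p2 ->]]]]]].
  rewrite gt_max => /andP[h1 h2]; exists u1, r1, u2, r2; split=> // t tI.
  by split; [exact: (sup01_lt h1)|exact: (sup01_lt h2)].
Qed.

Lemma thicken_le A e e' : e <= e' -> thicken A e `<=` thicken A e'.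
Proof. by move=> ee' p [pI [q Aq h]]; split=> //; exists q => //; exact: le_trans ee'. Qed.

Lemma cvg_hausdorffP (An : nat -> set ('rV[R]_d * R)) A :
  hausdorff (An n) A @[n --> \oo] --> 0%E <->
  forall e, 0 < e -> \forall n \near \oo, hausdorff_close (An n) A e.
Proof.
apply: cvg_witnessP => [n|n e e0 [h1 h2]|n e].
- by apply: le_ereal_inf_tmp => _ [e [e0 _ _] <-]; rewrite lee_fin ltW.
- by apply: ereal_inf_lbound; exists e.
- move=> /ereal_inf_lt[_ [e' [e0 h1 h2] <-]]; rewrite lte_fin => /ltW ee'.
  by split; apply: subset_trans (thicken_le ee').
Qed.

End Distances.

(** * Localization in time *)


Section Compactness.
Context {R : realType}.
Implicit Types (a b c t s del e : R).

(** A form of Cousin's lemma. The local property is available only when [t] is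
    strictly between [a] and [b] (or an end point of the unit interval), so the
    cut points of the subdivision avoid the times [t] that carry the jumps. The
    set [T] below collects the right ends of intervals all of whose points can
    serve as cut points: a supremum of single cut points might be attained at a
    jump and nowhere approached from the left. *)
Lemma interval_induction (P : R -> R -> Prop) :
  (forall a b c, 0 <= a -> a < b -> b < c -> c <= 1 ->
     P a b -> P b c -> P a c) ->
  (forall t, 0 <= t <= 1 -> exists2 del, 0 < del & forall a b,
     0 <= a -> a < b -> b <= 1 -> t - del < a -> b < t + del ->
     a < t \/ (a = 0 /\ t = 0) -> t < b \/ (b = 1 /\ t = 1) -> P a b) ->
  P 0 1.
Proof.
move=> Padd Ploc.
pose T := [set x : R | 0 < x <= 1 /\
  exists2 y, 0 <= y < x & forall b, y < b < x -> P 0 b].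
have [del0 del00 h0] := Ploc 0 (ltac:(by rewrite lexx ler01)).
have T0 : T (Num.min del0 1).
  split; first by rewrite lt_min del00 ltr01 ge_min lexx orbT.
  exists 0; first by rewrite lexx lt_min del00 ltr01.
  move=> b /andP[b0]; rewrite lt_min => /andP[bd b1].
  by apply: h0 => //; [exact: ltW|lra|rewrite add0r|right|left].
have T1 : has_sup T.
  by split; [exists (Num.min del0 1)|exists 1 => x [/andP[]]].
set c := sup T.
have c0 : 0 < c.
  apply: (@lt_le_trans _ _ (Num.min del0 1)); first by rewrite lt_min del00 ltr01.
  by apply: ub_le_sup => //; case: T1.
have c1 : c <= 1 by apply: ge_sup; [case: T1|move=> x [/andP[]]].
have [del del_gt0 hc] := Ploc c (ltac:(by rewrite (ltW c0))).
have [x Tx xc] := sup_adherent del_gt0 T1.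
have xlec : x <= c by apply: ub_le_sup => //; case: T1.
have [/andP[x0 x1] [y /andP[y0 yx] hy]] := Tx.
pose m := Num.max y (c - del); pose b0 := (m + x) / 2.
have [ym dm] : y <= m /\ c - del <= m by rewrite /m !le_max !lexx orbT.
have mx : m < x by rewrite gt_max yx.
have Pb0 : P 0 b0 by apply: hy; rewrite /b0; apply/andP; split; lra.
have b00 : 0 < b0 by rewrite /b0; lra.
have b0c : b0 < c by rewrite /b0; lra.
have db0 : c - del < b0 by rewrite /b0; lra.
move: c1; rewrite le_eqVlt => /predU1P[c1|c1].
  apply: (Padd 0 b0 1) => //; first lra.
  by apply: hc => //; [lra|lra|lra|left|right].
pose x' := Num.min (c + del) 1.
have cx' : c < x' by rewrite lt_min c1 ltrDl del_gt0.
have Tx' : T x'.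
  split; first by rewrite (lt_trans c0)//= ge_min lexx orbT.
  exists c; first by rewrite (ltW c0).
  move=> b /andP[cb]; rewrite lt_min => /andP[bd b1].
  apply: (Padd 0 b0 b) => //; [lra|lra|].
  by apply: hc => //; [lra|lra|lra|left|left].
by have := ub_le_sup (proj2 T1) Tx'; rewrite -/c leNgt cx'.
Qed.

(** The interval from [a] to [b] keeps a margin [e] from both ends of [(t - del, t + del)], and
    from [t] unless [t] is an end point of the unit interval. *)
Definition window t del e a b : Prop :=
  [/\ 0 <= a, a < b, b <= 1, t - del + e < a & b < t + del - e] /\
  (a < t - e \/ (a = 0 /\ t = 0)) /\ (t + e < b \/ (b = 1 /\ t = 1)).

Lemma window_exists t del eta a b : 0 < eta -> 0 <= a -> a < b -> b <= 1 ->
  t - del < a -> b < t + del ->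
  a < t \/ (a = 0 /\ t = 0) -> t < b \/ (b = 1 /\ t = 1) ->
  exists2 e, 0 < e <= eta & window t del e a b.
Proof.
move=> eta0 a0 ab b1 ha hb hat hbt.
have [e1 e10 h1] : exists2 e1, 0 < e1 &
    forall e, e < e1 -> a < t - e \/ (a = 0 /\ t = 0).
  case: hat => [at_|h]; last by exists 1 => // e _; right.
  by exists (t - a) => [|e he]; [lra|left; lra].
have [e2 e20 h2] : exists2 e2, 0 < e2 &
    forall e, e < e2 -> t + e < b \/ (b = 1 /\ t = 1).
  case: hbt => [tb|h]; last by exists 1 => // e _; right.
  by exists (b - t) => [|e he]; [lra|left; lra].
pose m := Num.min (Num.min (Num.min e1 e2) eta)
  (Num.min (a - (t - del)) (t + del - b)).
have m0 : 0 < m by rewrite !lt_min e10 e20 eta0/= !subr_gt0 ha.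
have : m <= m by [].
rewrite {2}/m !le_min => /andP[/andP[/andP[m1 m2] m3] /andP[m4 m5]].
exists (m / 2); first by apply/andP; split; lra.
by split; [split => //; lra|split; [apply: h1; lra|apply: h2; lra]].
Qed.

End Compactness.

Section Local.
Context {R : realType} {d : nat}.
Implicit Types (f g : R -> 'rV[R]_d) (x y z A B : 'rV[R]_d).
Implicit Types (a b c t s eta del e rho : R).

(** The subdivision supplied by [interval_induction] depends on [f] only, not
    on [n], so finitely many eventual properties are combined. *)
Lemma clustered_induction f eta (K : nat -> R -> Prop)
    (Q : nat -> R -> R -> Prop) :
  cadlag01 f -> 0 < eta ->
  (forall n a b c, 0 <= a -> a < b -> b < c -> c <= 1 ->
     Q n a b -> Q n b c -> Q n a c) ->
  (forall e, 0 < e -> \forall n \near \oo, K n e) ->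
  (forall n t del e a b, 0 <= t <= 1 -> clustered f t eta del ->
     window t del e a b -> del <= eta -> 0 < e <= eta -> K n e -> Q n a b) ->
  \forall n \near \oo, Q n 0 1.
Proof.
move=> hf eta0 Qadd hK hQ.
apply: (@interval_induction _ (fun a b => \forall n \near \oo, Q n a b)).
  by move=> a b c a0 ab bc c1; apply: filterS2 => n; exact: Qadd.
move=> t tI; have [del' del'0 cl'] := cadlag_clustered hf tI eta0.
pose del := Num.min del' eta.
have [dd de] : del <= del' /\ del <= eta by rewrite !ge_min !lexx orbT.
have cl : clustered f t eta del.
  by move=> z s /cl' h /andP[s1 s2]; apply: h; apply/andP; split; lra.
exists del; first by rewrite lt_min del'0.
move=> a b a0 ab b1 ta bt hat hbt.
have [e /andP[e0 ee] w] := window_exists eta0 a0 ab b1 ta bt hat hbt.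
have := hK e e0; apply: filterS => n Kn.
by apply: (hQ n t del e) => //; rewrite e0.
Qed.

(** Points of the graph of [g] are [e]-close to points of the graph of [f], which
    are [eta]-close to a cluster centre; the margin [e] of the window keeps the
    latter inside [(t - del, t + del)]. *)
Lemma graph_near_cluster f g t eta del e a b s z : clustered f t eta del ->
  window t del e a b -> e <= eta -> hausdorff_close (graph g) (graph f) e ->
  a <= s <= b -> graph g (z, s) ->
  [/\ enorm (z - left_val f t) <= 2 * eta \/ enorm (z - f t) <= 2 * eta,
      s < t - e -> enorm (z - left_val f t) <= 2 * eta
    & t + e < s -> enorm (z - f t) <= 2 * eta].
Proof.
move=> cl [[a0 ab b1 ha hb] _] ee [h _] /andP[as_ sb] /h/thickenP[_ [z' [s' [gz zz']]]].
rewrite ler_distl => /andP[ss1 ss2].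
have e0 : 0 <= e by rewrite (le_trans _ zz') ?enorm_ge0.
have [|hl hr hm] := cl z' s' (graph_complete gz); first by apply/andP; split; lra.
have key (v : 'rV[R]_d) : enorm (z' - v) <= eta -> enorm (z - v) <= 2 * eta.
  by move=> hc; have := enorm_triangle z' z v; lra.
split=> [|st|ts]; [|by apply/key/hl; lra|by apply/key/hr; lra].
have [st|ts|st] := ltgtP s' t; [by left; apply/key/hl|by right; apply/key/hr|].
have eta0 : 0 <= eta by rewrite (le_trans e0).
have [/= zE|/= zE] := gz.2; [left|right]; apply: key;
  by rewrite zE st subrr enorm0.
Qed.

(** The crossing time [c] is the supremum of the times at which [g] is close to
    [A]. Right continuity puts [g c] near [B], so the supremum is not attained;
    it is approached from the left, whence the bound on the left limit. *)
Lemma crossing g A B a b t e rho : cadlag01 g -> 0 <= a -> b <= 1 ->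
  0 <= e -> a < t - e -> t + e < b -> 2 * rho < enorm (A - B) ->
  (forall s, a <= s <= b -> enorm (g s - A) <= rho \/ enorm (g s - B) <= rho) ->
  (forall s, a <= s < t - e -> enorm (g s - A) <= rho) ->
  (forall s, t + e < s <= b -> enorm (g s - B) <= rho) ->
  exists c, [/\ t - e <= c <= t + e,
    forall s, c <= s <= b -> enorm (g s - B) <= rho,
    enorm (left_val g c - A) <= rho &
    forall s, s < c -> exists2 s', s < s' < c &
      a <= s' /\ enorm (g s' - A) <= rho].
Proof.
move=> hg a0 b1 e0 ate teb sepAB hAB hA hB.
have sep x : enorm (x - A) <= rho -> enorm (x - B) <= rho -> False.
  by have := enorm_triangle x A B; rewrite (enormB A x); lra.
pose S := [set s | a <= s <= b /\ enorm (g s - A) <= rho].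
have Sa : S a by split; [apply/andP; split|apply: hA; rewrite lexx]; lra.
have Sub : ubound S (t + e).
  move=> s [/andP[sa sb] sA]; rewrite leNgt; apply/negP => ts.
  by apply: (sep (g s)) => //; apply: hB; rewrite ts.
have Ssup : has_sup S by split; [exists a|exists (t + e)].
pose c := sup S.
have Sc s : S s -> s <= c by apply: ub_le_sup; exists (t + e).
have cte : c <= t + e by apply: ge_sup => //; exists a.
have tec : t - e <= c.
  rewrite leNgt; apply/negP => ct.
  have ac := Sc _ Sa.
  suff : S ((c + (t - e)) / 2) by move=> /Sc; lra.
  by split; [apply/andP; split|apply: hA; apply/andP; split]; lra.
have hBr s : c < s <= b -> enorm (g s - B) <= rho.
  move=> /andP[cs sb]; have sI : a <= s <= b by apply/andP; split; lra.
  case: (hAB s sI) => // sA; suff /Sc : S s by rewrite leNgt cs.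
  by [].
have hBc : enorm (g c - B) <= rho.
  apply: right_val_ball => //; first by apply/andP; split; lra.
  move=> k k0; pose m := Num.min (c + k) b.
  have [mk mb] : m <= c + k /\ m <= b by rewrite !ge_min !lexx orbT.
  have cm : c < m by rewrite lt_min; apply/andP; split; lra.
  exists ((c + m) / 2); first by apply/andP; split; lra.
  by apply: hBr; apply/andP; split; lra.
have adh s : s < c -> exists2 s', s < s' < c & a <= s' /\ enorm (g s' - A) <= rho.
  move=> sc; have cs : 0 < c - s by rewrite subr_gt0.
  have [s' Ss'] := sup_adherent cs Ssup; rewrite -/c opprB addrC subrK => ss'.
  exists s'; last by case: Ss' => /andP[].
  rewrite ss' lt_neqAle Sc// andbT; apply/eqP => s'c.
  by apply: (sep (g c)) => //; rewrite -s'c; case: Ss'.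
exists c; split=> //; first by rewrite tec.
- by move=> s /andP[]; rewrite le_eqVlt => /predU1P[<-//|cs sb]; apply: hBr; rewrite cs.
- apply: left_val_ball => //; first by apply/andP; split; lra.
  move=> k k0; have [|s' /andP[s1 s2] [_ s'A]] := adh (c - k); first lra.
  by exists s' => //; rewrite s1.
Qed.

End Local.

(** * Convergence of complete graphs *)


Section M2.
Context {R : realType} {d : nat}.
Implicit Types (f g : R -> 'rV[R]_d) (z : 'rV[R]_d) (a b t s eta del e : R).

(** There is no jump at 0, where the left value is [f 0], nor at 1, where [f] is
    left continuous. *)
Lemma jump_interior f t a b del e : cadlag01 f -> left_val f t <> f t ->
  window t del e a b -> a < t - e /\ t + e < b.
Proof.
move=> hf ft [_ [[hat|[_ t0]] [hbt|[_ t1]]]]; try by [].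
all: by case: ft; rewrite ?t0 ?t1 ?left_val0 ?left_val1.
Qed.

Lemma crossing_jump f g t eta del e a b : cadlag01 f -> cadlag01 g ->
  clustered f t eta del -> window t del e a b -> 0 < e <= eta ->
  hausdorff_close (graph g) (graph f) e ->
  4 * eta < enorm (left_val f t - f t) ->
  exists c, [/\ t - e <= c <= t + e, a < c < b,
    forall s, c <= s <= b -> enorm (g s - f t) <= 2 * eta,
    enorm (left_val g c - left_val f t) <= 2 * eta &
    forall s, s < c -> exists2 s', s < s' < c &
      a <= s' /\ enorm (g s' - left_val f t) <= 2 * eta].
Proof.
move=> hf hg cl w /andP[e0 ee] hJ jmp.
have [|at_ tb] := jump_interior hf _ w.
  by move=> E; move: jmp; rewrite E subrr enorm0; lra.
have [[a0 ab b1 ha hb] _] := w.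
have near s : a <= s <= b -> _ := fun sI =>
  graph_near_cluster cl w ee hJ sI (graph_val g (t := s)
    (ltac:(by case/andP: sI => h1 h2; apply/andP; split; lra))).
have [||||c [/andP[c1 c2] hB hA adh]] :=
    @crossing _ _ g (left_val f t) (f t) a b t e (2 * eta) hg a0 b1 (ltW e0) at_ tb.
- lra.
- by move=> s /near[].
- move=> s /andP[s1 s2]; have [|_ h _] := near s; last exact: h.
  by apply/andP; split; lra.
- move=> s /andP[s1 s2]; have [|_ _ h] := near s; last exact: h.
  by apply/andP; split; lra.
by exists c; split=> //; apply/andP; split; lra.
Qed.

(** Near a large jump of [f] the function [g] crosses from the first cluster to
    the second by a jump of its own, whose segment is then close to that of
    [f]. A segment of the complete graph of [f] of length at most [4 * eta] is
    instead approximated by one of its end points. *)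
Lemma complete_graphs_close f g t eta del e a b s z :
  cadlag01 f -> cadlag01 g -> 0 <= t <= 1 ->
  clustered f t eta del -> window t del e a b -> del <= eta -> 0 < e <= eta ->
  hausdorff_close (graph g) (graph f) e -> a <= s <= b ->
  (complete_graph g (z, s) -> thicken (complete_graph f) (5 * eta) (z, s)) /\
  (complete_graph f (z, s) -> thicken (complete_graph g) (5 * eta) (z, s)).
Proof.
move=> hf hg tI cl w de eI hJ sI.
have [[a0 ab b1 ha hb] _] := w; have /andP[as_ sb] := sI; have /andP[e0 ee] := eI.
have s01 : 0 <= s <= 1 by apply/andP; split; lra.
split=> [[_ /= zs]|].
  have [hl _ _] := graph_near_cluster cl w ee hJ sI (graph_left g s01).
  have [hr _ _] := graph_near_cluster cl w ee hJ sI (graph_val g s01).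
  suff [z' z't zz'] : exists2 z', segm (left_val f t) (f t) z' &
      enorm (z - z') <= 2 * eta.
    apply/thickenP; split; first by rewrite I01E.
    have t01 : I01 t by rewrite I01E.
    exists z', t; split; [exact: conj t01 z't|by apply: (le_trans zz'); lra|].
    by rewrite ler_distl; apply/andP; split; lra.
  case: hl => hl; case: hr => hr.
  - by exists (left_val f t); [exact: segm_l|exact: segm_ball zs].
  - exact: segm_near zs.
  - by have [z' /segmC h ?] := segm_near hl hr zs; exists z'.
  - by exists (f t); [exact: segm_r|exact: segm_ball zs].
move=> zs; apply/thickenP; split; first by rewrite I01E.
have via z1 : graph f (z1, s) -> enorm (z - z1) <= 4 * eta -> exists z' s',
    [/\ complete_graph g (z', s'), enorm (z - z') <= 5 * eta
      & `|s - s'| <= 5 * eta].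
  case: hJ => _ h /h/thickenP[_ [z' [s' [gz zz' ss']]]] z1z.
  exists z', s'; split; [exact: graph_complete| |lra].
  by have := enorm_triangle z1 z z'; lra.
have sdel : t - del < s < t + del by apply/andP; split; lra.
have gfs := graph_val f s01.
have [hl hr hm] := cl _ _ zs sdel.
have [hl' hr' _] := cl _ _ (graph_complete gfs) sdel.
have [st|ts|st] := ltgtP s t.
- apply: (via (f s)) => //.
  have := enorm_triangle (left_val f t) z (f s).
  by have := hl st; have := hl' st; rewrite (enormB (f s)); lra.
- apply: (via (f s)) => //.
  have := enorm_triangle (f t) z (f s).
  by have := hr ts; have := hr' ts; rewrite (enormB (f s)); lra.
have {hm} zt := hm st.
have [small|big] := leP (enorm (left_val f t - f t)) (4 * eta).
  apply: (via (f s)) => //; rewrite st.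
  by apply: (segm_ball small _ zt); rewrite subrr enorm0; lra.
have [c [/andP[c1 c2] /andP[ac cb] hB hA _]] := crossing_jump hf hg cl w eI hJ big.
rewrite enormB in hA; have := hB c (ltac:(by rewrite lexx ltW)); rewrite enormB => hBc.
have [z' z'c zz'] := segm_near hA hBc zt.
have c01 : I01 c.
  by rewrite I01E (le_trans a0 (ltW ac)) (le_trans (ltW cb) b1).
exists z', c; split; [exact: conj c01 z'c|by apply: (le_trans zz'); clear -e0 ee; lra|].
by rewrite ler_distl; apply/andP; clear -c1 c2 e0 ee st; split; lra.
Qed.

Lemma cvg_J2_M2 (fn : nat -> R -> 'rV[R]_d) f :
  (forall n, cadlag01 (fn n)) -> cadlag01 f -> cvg_for dJ2 fn f ->
  cvg_for dM2 fn f.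
Proof.
move=> hfn hf /cvg_hausdorffP hJ; apply/cvg_hausdorffP => e e0.
have eta0 : 0 < e / 5 by rewrite divr_gt0.
pose Q n a b := forall s z, a <= s <= b ->
  (complete_graph (fn n) (z, s) -> thicken (complete_graph f) e (z, s)) /\
  (complete_graph f (z, s) -> thicken (complete_graph (fn n)) e (z, s)).
have : \forall n \near \oo, Q n 0 1.
  apply: (clustered_induction hf eta0 _ hJ) => [n a b c _ _ _ _ h1 h2|].
    move=> s z /andP[as_ sc]; have [sb|/ltW bs] := leP s b.
      by apply: h1; rewrite as_.
    by apply: h2; rewrite bs.
  move=> n t del k a b tI cl w dele ke hJn s z sI.
  have := complete_graphs_close z hf (hfn n) tI cl w dele ke hJn sI.
  by have -> : 5 * (e / 5) = e by field.
apply: filterS => n Qn.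
split=> -[z s] zs.
- have := zs.1; rewrite /= I01E => sI.
  by have [h _] := Qn s z sI; exact: h.
- have := zs.1; rewrite /= I01E => sI.
  by have [_ h] := Qn s z sI; exact: h.
Qed.

Lemma cvg_M1_M2 (fn : nat -> R -> 'rV[R]_d) f :
  cvg_for dM1 fn f -> cvg_for dM2 fn f.
Proof.
move=> /cvg_M1P hM; apply/cvg_hausdorffP => e e0.
have := hM e e0; apply: filterS => n [u1 [r1 [u2 [r2 [p1 p2 h]]]]].
have [_ _ _ _ <-] := p1; have [_ _ _ _ <-] := p2.
have [_ _ r1I _ _] := p1; have [_ _ r2I _ _] := p2.
split=> _ [t tI <-]; apply/thickenP; (split; first by auto).
- by have [h1 h2] := h t tI; exists (u2 t), (r2 t); split=> //; exists t.
- have [h1 h2] := h t tI; exists (u1 t), (r1 t).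
  by rewrite enormB distrC; split=> //; exists t.
Qed.

End M2.

(** * From M1 and J2 to J1 *)


Section ToJ1.
Context {R : realType} {d : nat}.
Implicit Types (f g : R -> 'rV[R]_d) (l : R -> R) (a b c t s eta del e : R).

(** Inside the window a parametrization of the complete graph of [f] cannot come
    back near [left_val f t] after having been near [f t]: the first visit is not
    before time [t], the second one not after, and at time [t] itself the
    distance to [left_val f t] is non-decreasing. A uniformly close
    parametrization of [g] inherits this. *)
Lemma no_return f g t eta del e a b s s' : clustered f t eta del ->
  window t del e a b -> e <= eta -> M1_close g f e ->
  6 * eta < enorm (left_val f t - f t) -> a <= s -> s < s' -> s' <= b ->
  enorm (g s - f t) <= 2 * eta -> enorm (g s' - left_val f t) <= 2 * eta ->
  False.
Proof.
move=> cl [[a0 ab b1 ha hb] _] ee [u1 [r1 [u2 [r2 [p1 p2 close]]]]] jmp as_ ss' sb gB gA.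
have [_ _ r1I mono1 im1] := p1; have [_ _ r2I mono2 im2] := p2.
have lift x : a <= x <= b -> exists2 k, I01 k & u1 k = g x /\ r1 k = x.
  move=> /andP[ax xb].
  have : complete_graph g (g x, x).
    by apply/graph_complete/graph_val; apply/andP; split; lra.
  by rewrite -im1 => -[k kI [uk rk]]; exists k.
have [k kI [u1k r1k]] := lift s (ltac:(by apply/andP; split; lra)).
have [k' kI' [u1k' r1k']] := lift s' (ltac:(by apply/andP; split; lra)).
have kk' : k <= k'.
  rewrite leNgt; apply/negP => /ltW kk'.
  by have [] := mono1 _ _ kI' kI kk'; rewrite /= r1k r1k'; lra.
have [ck rk] := close k kI; have [ck' rk'] := close k' kI'.
rewrite u1k in ck; rewrite u1k' in ck'.
move: rk rk'; rewrite r1k r1k' !ler_distl => /andP[k1 k2] /andP[k3 k4].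
have gr j : I01 j -> complete_graph f (u2 j, r2 j).
  by move=> jI; rewrite -im2; exists j.
have [|hl hr _] := cl _ _ (gr k kI); first by apply/andP; split; lra.
have [|hl' hr' _] := cl _ _ (gr k' kI'); first by apply/andP; split; lra.
have uB := enorm_triangle (g s) (u2 k) (f t).
have uA := enorm_triangle (g s') (u2 k') (left_val f t).
rewrite (enormB _ (g s)) in uB.
rewrite (enormB _ (g s')) (enormB _ (left_val f t)) in uA.
have tr := enorm_triangle (u2 k) (left_val f t) (f t).
have tr' := enorm_triangle (u2 k') (left_val f t) (f t).
have tk : t <= r2 k by rewrite leNgt; apply/negP => /hl; rewrite enormB; lra.
have tk' : r2 k' <= t by rewrite leNgt; apply/negP => /hr'; lra.
have [/=|/= [rkk']] := mono2 _ _ kI kI' kk'; first lra.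
have -> : r2 k' = t by lra.
have -> : r2 k = t by lra.
lra.
Qed.

(** A good time change on an interval, with fixed end points so that such time
    changes can be glued. The constant 9 is 6 + 2 + 1: jumps of size at most
    [6 * eta] are not resolved, [g] is [2 * eta]-close and [f] is [eta]-close to
    a cluster centre. *)
Definition matched f g eta a b l : Prop :=
  [/\ forall s s', a <= s -> s < s' -> s' <= b -> l s < l s',
      l a = a, l b = b,
      forall s, a <= s <= b -> exists2 s', a <= s' <= b & l s' = s &
      forall s, a <= s <= b -> enorm (g (l s) - f s) <= 9 * eta /\
                               `|l s - s| <= eta].

Lemma matched_glue f g eta a b c l1 l2 : a < b -> b < c ->
  matched f g eta a b l1 -> matched f g eta b c l2 ->
  matched f g eta a c (fun s => if s <= b then l1 s else l2 s).
Proof.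
move=> ab bc [inc1 l1a l1b sur1 h1] [inc2 l2b l2c sur2 h2].
split=> [s s' as_ ss' sc||||].
- have [sb|bs] := leP s b; have [sb'|bs'] := leP s' b.
  + exact: inc1.
  + apply: (@le_lt_trans _ _ b); last by rewrite -l2b; apply: inc2.
    rewrite -l1b; move: sb; rewrite le_eqVlt => /predU1P[->//|sb].
    by apply/ltW/inc1.
  + lra.
  + by apply: inc2 => //; exact: ltW.
- by rewrite (ltW ab).
- by rewrite leNgt bc.
- move=> s /andP[as_ sc]; have [sb|bs] := leP s b.
    have [|s' /andP[s1 s2] <-] := sur1 s; first by rewrite as_.
    by exists s'; [apply/andP; split; lra|rewrite s2].
  have [|s' /andP[s1 s2] s'E] := sur2 s; first by rewrite (ltW bs).
  have bs' : b < s'.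
    rewrite lt_neqAle s1 andbT; apply/eqP => bE.
    by move: bs; rewrite -s'E -bE l2b ltxx.
  by exists s'; [apply/andP; split; lra|rewrite leNgt bs'].
- move=> s /andP[as_ sc]; have [sb|bs] := leP s b; first by apply: h1; rewrite as_.
  by apply: h2; rewrite (ltW bs).
Qed.

(** The piecewise linear map with a single kink, sending [t] to [c]. *)
Definition kink a b t c s : R :=
  if s < t then a + (c - a) / (t - a) * (s - a)
  else b - (b - c) / (b - t) * (b - s).

Section Kink.
Variables a b t c : R.
Hypotheses (at_ : a < t) (tb : t < b) (ac : a < c) (cb : c < b).

Let p0 : 0 < (c - a) / (t - a). Proof. by rewrite divr_gt0 ?subr_gt0. Qed.
Let q0 : 0 < (b - c) / (b - t). Proof. by rewrite divr_gt0 ?subr_gt0. Qed.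
Let p1 : (c - a) / (t - a) * (t - a) = c - a.
Proof. by rewrite divfK// gt_eqF ?subr_gt0. Qed.
Let q1 : (b - c) / (b - t) * (b - t) = b - c.
Proof. by rewrite divfK// gt_eqF ?subr_gt0. Qed.

Lemma kink_lt s : s < t -> kink a b t c s < c.
Proof.
move=> st; rewrite /kink st.
have := p1; have : 0 < (c - a) / (t - a) * (t - s) by rewrite mulr_gt0 ?subr_gt0.
  lra.
Qed.

Lemma kink_ge s : t <= s -> c <= kink a b t c s.
Proof.
move=> ts; rewrite /kink ltNge ts/=.
have := q1; have : 0 <= (b - c) / (b - t) * (s - t) by rewrite mulr_ge0 ?subr_ge0// ltW.
  lra.
Qed.

Lemma kink_increasing s s' : s < s' -> kink a b t c s < kink a b t c s'.
Proof.
move=> ss'; have [st|ts] := ltP s t; have [st'|ts'] := ltP s' t.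
- rewrite /kink st st'.
  have : 0 < (c - a) / (t - a) * (s' - s) by rewrite mulr_gt0 ?subr_gt0.
  by lra.
- exact: lt_le_trans (kink_lt st) (kink_ge ts').
- lra.
- rewrite /kink !ltNge ts ts'/=.
  have : 0 < (b - c) / (b - t) * (s' - s) by rewrite mulr_gt0 ?subr_gt0.
  lra.
Qed.

Lemma kink_a : kink a b t c a = a.
Proof. by rewrite /kink at_ subrr mulr0 addr0. Qed.

Lemma kink_b : kink a b t c b = b.
Proof. by rewrite /kink ltNge (ltW tb)/= subrr mulr0 subr0. Qed.

Lemma kink_surj s : a <= s <= b -> exists2 s', a <= s' <= b & kink a b t c s' = s.
Proof.
move=> /andP[as_ sb]; have [sc|cs] := ltP s c.
  pose k := (s - a) / (c - a).
  have kE : k * (c - a) = s - a by rewrite /k divfK// gt_eqF ?subr_gt0.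
  have k0 : 0 <= k by rewrite divr_ge0 ?subr_ge0// ltW.
  have k1 : k < 1 by rewrite /k ltr_pdivrMr ?subr_gt0// mul1r; lra.
  clearbody k; have h1 : 0 <= k * (t - a) by rewrite mulr_ge0// subr_ge0 ltW.
  have h2 : k * (t - a) < t - a by rewrite gtr_pMl// subr_gt0.
  have := tb; exists (a + k * (t - a)); first by apply/andP; split; lra.
  rewrite /kink ifT; last lra.
  by rewrite [a + k * _ - a]addrC addKr mulrCA p1 kE addrC subrK.
pose k := (b - s) / (b - c).
have kE : k * (b - c) = b - s by rewrite /k divfK// gt_eqF ?subr_gt0.
have k0 : 0 <= k by rewrite divr_ge0 ?subr_ge0// ltW.
have k1 : k <= 1 by rewrite /k ler_pdivrMr ?subr_gt0// mul1r; lra.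
clearbody k; have h1 : 0 <= k * (b - t) by rewrite mulr_ge0// subr_ge0 ltW.
have h2 : k * (b - t) <= b - t by rewrite ler_piMl// subr_ge0 ltW.
have := at_; exists (b - k * (b - t)); first by apply/andP; split; lra.
rewrite /kink ifF; last by apply/negbTE; rewrite -leNgt; lra.
by rewrite subKr mulrCA q1 kE subKr.
Qed.

Lemma kink_dist e s : `|c - t| <= e -> a <= s <= b -> `|kink a b t c s - s| <= e.
Proof.
rewrite ler_distl => /andP[h1 h2] /andP[as_ sb].
have [st|ts] := ltP s t.
  have -> : kink a b t c s - s = (c - t) * ((s - a) / (t - a)).
    by rewrite /kink st; field; rewrite gt_eqF ?subr_gt0.
  have k0 : 0 <= (s - a) / (t - a) by rewrite divr_ge0 ?subr_ge0// ltW.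
  rewrite normrM (ger0_norm k0) (@le_trans _ _ `|c - t|)//; last first.
    by rewrite ler_distl; apply/andP.
  by rewrite ler_piMr// ler_pdivrMr ?subr_gt0// mul1r lerD2r ltW.
have -> : kink a b t c s - s = (c - t) * ((b - s) / (b - t)).
  by rewrite /kink ltNge ts/=; field; rewrite gt_eqF ?subr_gt0.
have k0 : 0 <= (b - s) / (b - t) by rewrite divr_ge0 ?subr_ge0// ltW.
rewrite normrM (ger0_norm k0) (@le_trans _ _ `|c - t|)//; last first.
  by rewrite ler_distl; apply/andP.
by rewrite ler_piMr// ler_pdivrMr ?subr_gt0// mul1r lerD2l lerN2.
Qed.

End Kink.

(** At a large jump of [f] the two clusters are separated by the crossing time
    [c] of [g]: there is no return, so the values of [g] before [c] are all in
    the first cluster. Elsewhere the identity is good enough. *)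
Lemma matched_window f g t eta del e a b : cadlag01 f -> cadlag01 g ->
  0 <= t <= 1 -> clustered f t eta del -> window t del e a b -> 0 < e <= eta ->
  M1_close g f e -> hausdorff_close (graph g) (graph f) e ->
  exists l, matched f g eta a b l.
Proof.
move=> hf hg tI cl w eI hM hJ.
have [[a0 ab b1 ha hb] _] := w; have /andP[e0 ee] := eI.
have fnear s : a <= s <= b ->
    (s < t -> enorm (f s - left_val f t) <= eta) /\
    (t <= s -> enorm (f s - f t) <= eta).
  move=> /andP[as_ sb].
  have s01 : 0 <= s <= 1 by apply/andP; split; lra.
  have [|hl hr _] := cl _ _ (graph_complete (graph_val f s01)).
    by apply/andP; split; lra.
  split=> //; rewrite le_eqVlt => /predU1P[->|//].
  by rewrite subrr enorm0; lra.
have gnear s : a <= s <= b -> enorm (g s - left_val f t) <= 2 * eta \/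
    enorm (g s - f t) <= 2 * eta.
  move=> sI; have s01 : 0 <= s <= 1.
    by move: sI => /andP[as_ sb]; apply/andP; split; lra.
  by have [] := graph_near_cluster cl w ee hJ sI (graph_val g s01).
have [small|big] := leP (enorm (left_val f t - f t)) (6 * eta).
  exists id; split=> // s sI; first by exists s.
  split; last by rewrite subrr normr0; lra.
  have [fl fr] := fnear s sI.
  have hgB : enorm (g s - f t) <= 8 * eta.
    have := enorm_triangle (left_val f t) (g s) (f t).
    by case: (gnear s sI); lra.
  have hgA : enorm (g s - left_val f t) <= 8 * eta.
    have := enorm_triangle (f t) (g s) (left_val f t).
    by rewrite (enormB (f t)); case: (gnear s sI); lra.
  have [/fl|/fr] := ltP s t; rewrite enormB.
    by have := enorm_triangle (left_val f t) (g s) (f s); lra.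
  by have := enorm_triangle (f t) (g s) (f s); lra.
have [|at_ tb] := jump_interior hf _ w.
  by move=> E; move: big; rewrite E subrr enorm0; lra.
have [|c [/andP[c1 c2] /andP[ac cb] hB _ adh]] := crossing_jump hf hg cl w eI hJ.
  by apply: le_lt_trans big; lra.
have hA s : a <= s < c -> enorm (g s - left_val f t) <= 2 * eta.
  move=> /andP[as_ sc]; have [|//|gB] := gnear s; first by apply/andP; split; lra.
  have [s' /andP[ss' sc'] [_ gA]] := adh s sc.
  by case: (no_return cl w ee hM big as_ ss' _ gB gA); lra.
have at' : a < t by lra.
have tb' : t < b by lra.
exists (kink a b t c); split.
- by move=> s s' _ ss' _; exact: kink_increasing.
- exact: kink_a.
- exact: kink_b.
- exact: kink_surj.
move=> s sI; split; last first.
  by apply: kink_dist => //; rewrite ler_distl; apply/andP; split; lra.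
have [fl fr] := fnear s sI; have /andP[as_ sb] := sI.
have [st|ts] := ltP s t.
  have := fl st; rewrite enormB.
  suff /hA : a <= kink a b t c s < c.
    by have := enorm_triangle (left_val f t) (g (kink a b t c s)) (f s); lra.
  rewrite kink_lt// andbT; move: as_; rewrite le_eqVlt => /predU1P[<-|as_].
    by rewrite kink_a.
  by rewrite -{1}[a](@kink_a a b t c)// ltW// kink_increasing.
have := fr ts; rewrite enormB.
suff /hB : c <= kink a b t c s <= b.
  by have := enorm_triangle (f t) (g (kink a b t c s)) (f s); lra.
rewrite kink_ge//=; move: sb; rewrite le_eqVlt => /predU1P[->|sb].
  by rewrite kink_b.
by rewrite -{2}[b](@kink_b a b t c)// ltW// kink_increasing.
Qed.

Lemma matched_J1_close f g eta l : matched f g eta 0 1 l ->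
  J1_close g f (9 * eta).
Proof.
move=> [inc l0 l1 sur h].
have mono : {in `[(0 : R), 1] &, {mono l : x y / x <= y}}.
  apply: le_mono_in => x y; rewrite !in_itv/= => /andP[x0 x1] /andP[y0 y1] xy.
  exact: inc.
have eta0 : 0 <= eta.
  have [|_ hh] := h 0; first by rewrite lexx ler01.
  by rewrite (le_trans _ hh).
exists l; last first.
  by move=> t; rewrite I01E => tI; have [h1 h2] := h t tI; split=> //; lra.
have surj : set_surj I01 I01 l.
  move=> y; rewrite I01E => yI; have [x xI <-] := sur y yI.
  by exists x => //; rewrite I01E.
split; first by apply: segment_inc_surj_continuous => //; rewrite l0 l1.
split=> //.
- move=> x; rewrite /= !I01E => /andP[x0 x1].
  apply/andP; split; first by rewrite -[leLHS]l0 mono ?in_itv/= ?lexx ?ler01 ?x0.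
  by rewrite -[leRHS]l1 mono ?in_itv/= ?lexx ?ler01 ?x0.
- move=> x y; rewrite !inE !I01E => xI yI lxy.
  by apply/eqP; rewrite eq_le -(mono x y) ?in_itv// -(mono y x) ?in_itv// lxy lexx.
Qed.

Lemma cvg_M1_J2_J1 (fn : nat -> R -> 'rV[R]_d) f :
  (forall n, cadlag01 (fn n)) -> cadlag01 f ->
  cvg_for dM1 fn f -> cvg_for dJ2 fn f -> cvg_for dJ1 fn f.
Proof.
move=> hfn hf /cvg_M1P hM /cvg_hausdorffP hJ; apply/cvg_J1P => e e0.
have eta0 : 0 < e / 9 by rewrite divr_gt0.
pose K n k := M1_close (fn n) f k /\ hausdorff_close (graph (fn n)) (graph f) k.
have : \forall n \near \oo, exists l, matched f (fn n) (e / 9) 0 1 l.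
  apply: (@clustered_induction _ _ f (e / 9) K
    (fun n a b => exists l, matched f (fn n) (e / 9) a b l)) => //.
  - move=> n a b c _ ab bc _ [l1 m1] [l2 m2]; eexists; exact: matched_glue m1 m2.
  - by move=> k k0; apply: filterS2 (hM k k0) (hJ k k0).
  - move=> n t del k a b tI cl w _ kI [h1 h2].
    exact: (matched_window hf (hfn n) tI cl w kI).
apply: filterS => n [l /matched_J1_close].
by have -> : 9 * (e / 9) = e by field.
Qed.

End ToJ1.

(** * Increasing time changes *)


Section Composition.
Context {R : realType} {d : nat}.
Implicit Types (f g : R -> 'rV[R]_d) (l : R -> R) (s t e : R).

Definition increasing_bijection l : Prop :=
  [/\ forall s s', 0 <= s -> s < s' -> s' <= 1 -> l s < l s', l 0 = 0, l 1 = 1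
    & forall t, 0 <= t <= 1 -> exists2 s, 0 <= s <= 1 & l s = t].

(** A decreasing bijection moves 0 by 1, so it is excluded by closeness to the
    identity. *)
Lemma time_change_increasing l e : time_change l -> e < 1 / 2 ->
  (forall t, I01 t -> `|l t - t| <= e) -> increasing_bijection l.
Proof.
move=> [lc [lI linj lsur]] e1 close.
have I0 : I01 (0 : R) by rewrite I01E lexx ler01.
have I1 : I01 (1 : R) by rewrite I01E lexx ler01.
have le01 : l 0 <= l 1.
  move: (close 0 I0) (close 1 I1); rewrite !ler_distl => /andP[_ h0] /andP[h1 _].
  lra.
have mono : {in `[(0 : R), 1] &, {mono l : x y / x <= y}}.
  apply: segment_continuous_inj_le => // x y xI yI; apply: linj; exact: mem_set.
have mono' x y : 0 <= x <= 1 -> 0 <= y <= 1 -> (l x <= l y) = (x <= y).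
  by move=> xI yI; apply: mono; rewrite in_itv.
have sur t : 0 <= t <= 1 -> exists2 s, 0 <= s <= 1 & l s = t.
  by rewrite -I01E => /lsur[s sI <-]; exists s => //; rewrite -I01E.
have lb t : 0 <= t <= 1 -> 0 <= l t <= 1 by rewrite -!I01E; exact: lI.
have z0 : 0 <= (0 : R) <= 1 by rewrite lexx ler01.
have z1 : 0 <= (1 : R) <= 1 by rewrite lexx ler01.
split=> //.
- move=> s s' s0 ss' s1; rewrite ltNge mono' -?ltNge//; apply/andP; split; lra.
- have [s sI ls] := sur 0 z0; apply/eqP; rewrite eq_le.
  have /andP[-> _] := lb 0 z0; rewrite andbT -{2}ls mono'//.
  by case/andP: sI.
- have [s sI ls] := sur 1 z1; apply/eqP; rewrite eq_le.
  have /andP[_ ->] := lb 1 z1; rewrite /= -{1}ls mono'//.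
  by case/andP: sI.
Qed.

Section Comp.
Variables (g : R -> 'rV[R]_d) (l : R -> R).
Hypotheses (hg : cadlag01 g) (hl : increasing_bijection l).

Lemma increasing_bijection_I01 t : 0 <= t <= 1 -> 0 <= l t <= 1.
Proof.
have [inc l0 l1 _] := hl; move=> /andP[]; rewrite le_eqVlt => /predU1P[<- _|t0].
  by rewrite l0 lexx ler01.
rewrite le_eqVlt => /predU1P[->|t1]; first by rewrite l1 lexx ler01.
apply/andP; split; apply/ltW; [rewrite -l0|rewrite -[ltRHS]l1];
  by apply: inc => //; exact: ltW.
Qed.

(** The left neighbourhoods of [t] and of [l t] correspond through [l]. *)
Lemma comp_cvg_left t : 0 < t <= 1 ->
  (g \o l) s @[s --> t^'-] --> left_val g (l t).
Proof.
have [inc l0 l1 sur] := hl; move=> /andP[t0 t1].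
have lt0 : 0 < l t by rewrite -l0; apply: inc.
have /andP[_ lt1] := @increasing_bijection_I01 t (ltac:(by rewrite ltW)).
apply/cvg_enormP => e e0; apply/at_leftP.
have [|del del0 h] := cadlag_left hg (t := l t) _ e0; first by rewrite lt0.
pose y := Num.max (l t - del) 0.
have yt : y < l t by rewrite gt_max lt0 andbT; clear -del0; lra.
have [dy y0] : l t - del <= y /\ 0 <= y by rewrite /y !le_max !lexx orbT.
have [|s0 /andP[s00 s01] ls0] := sur y; first by rewrite y0 (le_trans (ltW yt)).
have s0t : s0 < t.
  rewrite ltNge; apply/negP; rewrite le_eqVlt => /predU1P[ts|ts].
    by move: yt; rewrite -ls0 ts ltxx.
  by have := inc _ _ (ltW t0) ts s01; rewrite ls0; clear -yt; lra.
exists (t - s0); first by rewrite subr_gt0.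
move=> s /andP[]; rewrite opprB addrC subrK => s0s st.
have := inc _ _ s00 s0s (le_trans (ltW st) t1); rewrite ls0 => ys.
have lst := inc _ _ (le_trans s00 (ltW s0s)) st t1.
by apply: h; rewrite lst (le_lt_trans dy).
Qed.

Lemma comp_left_val t : 0 <= t <= 1 -> left_val (g \o l) t = left_val g (l t).
Proof.
have [_ l0 _ _] := hl.
move=> /andP[]; rewrite le_eqVlt => /predU1P[<- _|t0 t1].
  by rewrite left_val0 /= l0 left_val0.
rewrite {1}/left_val gt_eqF//; apply: (cvg_lim (@norm_hausdorff _ _)).
by apply: comp_cvg_left; rewrite t0.
Qed.

Lemma comp_cadlag : cadlag01 (g \o l).
Proof.
have [inc l0 l1 sur] := hl; split.
- move=> t /andP[t0 t1].
  have lt1 : l t < 1 by rewrite -l1; apply: inc.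
  have /andP[lt0 _] := @increasing_bijection_I01 t (ltac:(by rewrite t0 ltW)).
  apply/cvg_enormP => e e0; apply/at_rightP.
  have [|del del0 h] := cadlag_right hg (t := l t) _ e0; first by rewrite lt0.
  pose y := Num.min (l t + del) 1.
  have ty : l t < y by rewrite lt_min lt1 andbT; clear -del0; lra.
  have [dy y1] : y <= l t + del /\ y <= 1 by rewrite /y !ge_min !lexx orbT.
  have [|s0 /andP[s00 s01] ls0] := sur y; first by rewrite y1 (le_trans lt0 (ltW ty)).
  have ts0 : t < s0.
    rewrite ltNge; apply/negP; rewrite le_eqVlt => /predU1P[ts|ts].
      by move: ty; rewrite -ls0 ts ltxx.
    by have := inc _ _ s00 ts (ltW t1); rewrite ls0; clear -ty; lra.
  exists (s0 - t); first by rewrite subr_gt0.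
  move=> s /andP[ts]; rewrite addrC subrK => ss0.
  have := inc _ _ (le_trans t0 (ltW ts)) ss0 s01; rewrite ls0 => sy.
  have lts := inc _ _ t0 ts (le_trans (ltW ss0) s01).
  by apply: h; rewrite (ltW lts) (lt_le_trans sy).
- by move=> t tI; apply/cvg_ex; exists (left_val g (l t)); exact: comp_cvg_left.
- have := @comp_cvg_left 1 (ltac:(by rewrite ltr01 lexx)).
  by rewrite /= l1 left_val1.
Qed.

End Comp.

Lemma left_val_close f g e : cadlag01 f -> cadlag01 g ->
  (forall t, 0 <= t <= 1 -> enorm (f t - g t) <= e) ->
  forall t, 0 <= t <= 1 -> enorm (left_val f t - left_val g t) <= e.
Proof.
move=> hf hg h t /andP[]; rewrite le_eqVlt => /predU1P[<- _|t0 t1].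
  by rewrite !left_val0; apply: h; rewrite lexx ler01.
have tI : 0 < t <= 1 by rewrite t0.
apply/ler_addgt0Pl => k k0; have k2 : 0 < k / 2 by rewrite divr_gt0.
have [d1 d10 h1] := cadlag_left hf tI k2.
have [d2 d20 h2] := cadlag_left hg tI k2.
pose m := Num.max (Num.max (t - d1) (t - d2)) 0.
have mt : m < t by rewrite !gt_max t0 andbT; clear -d10 d20; apply/andP; split; lra.
have [m1 m2 m0] : [/\ t - d1 <= m, t - d2 <= m & 0 <= m].
  by rewrite /m !le_max !lexx !orbT.
pose s := (m + t) / 2.
have {}h1 : enorm (f s - left_val f t) < k / 2.
  by apply: h1; rewrite /s; clear -m1 mt; apply/andP; split; lra.
have {}h2 : enorm (g s - left_val g t) < k / 2.
  by apply: h2; rewrite /s; clear -m2 mt; apply/andP; split; lra.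
have {h} hs : enorm (f s - g s) <= e.
  by apply: h; rewrite /s; clear -m0 mt t1; apply/andP; split; lra.
have tr1 := enorm_triangle (f s) (left_val f t) (left_val g t).
have tr2 := enorm_triangle (g s) (f s) (left_val g t).
rewrite enormB in h1; clear -h1 h2 hs tr1 tr2; lra.
Qed.

Lemma cvg_J1_J2 (fn : nat -> R -> 'rV[R]_d) f :
  (forall n, cadlag01 (fn n)) -> cadlag01 f -> cvg_for dJ1 fn f ->
  cvg_for dJ2 fn f.
Proof.
move=> hfn hf /cvg_J1P hJ; apply/cvg_hausdorffP => e e0.
pose e' := Num.min e (1 / 3).
have e'0 : 0 < e' by rewrite lt_min e0 divr_gt0.
have [e'e e'1] : e' <= e /\ e' <= 1 / 3 by rewrite !ge_min !lexx orbT.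
have := hJ e' e'0; apply: filterS => n [l lT h].
have e2 : e' < 1 / 2 by clear -e'1; lra.
have inc := time_change_increasing lT e2 (fun t tI => (h t tI).2).
have hc := comp_cadlag (hfn n) inc.
have hv t : 0 <= t <= 1 -> enorm ((fn n \o l) t - f t) <= e'.
  by rewrite -I01E => /h[].
have ht t : 0 <= t <= 1 -> `|l t - t| <= e by rewrite -I01E => /h[_ /le_trans->].
have hL := left_val_close hc hf hv.
have lI := increasing_bijection_I01 inc.
split=> -[z s] [/=]; rewrite I01E => sI zs; apply/thickenP; (split; first by rewrite I01E).
- have [_ _ _ /(_ s sI)[t tI ls]] := inc; subst s.
  case: zs => ->.
  + exists (left_val f t), t; split; [exact: graph_left| |exact: ht].
    by rewrite -comp_left_val// (le_trans (hL t tI)).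
  + exists (f t), t; split; [exact: graph_val| |exact: ht].
    exact: le_trans (hv t tI) e'e.
- case: zs => ->.
  + exists (left_val (fn n) (l s)), (l s); rewrite distrC enormB.
    split; [by apply/graph_left/lI| |exact: ht].
    by rewrite -comp_left_val// (le_trans (hL s sI)).
  + exists (fn n (l s)), (l s); rewrite distrC enormB.
    split; [by apply/graph_val/lI| |exact: ht].
    exact: le_trans (hv s sI) e'e.
Qed.

End Composition.

(** * Clocks resting at the jump times *)


Section JumpTimes.
Context {R : realType} {d : nat}.
Implicit Types (f : R -> 'rV[R]_d) (S sigma r : R -> R) (J : set R).
Implicit Types (a b s t w e : R).

Definition jump_times f : set R := [set t | 0 <= t <= 1 /\ left_val f t <> f t].

(** Around any [t] the values and left values of [f] at the same time [s <> t]
    lie in a common small cluster, so [t] is the only possible large jump. *)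
Lemma finite_large_jumps f e : cadlag01 f -> 0 < e ->
  finite_set [set t | 0 <= t <= 1 /\ e < enorm (left_val f t - f t)].
Proof.
move=> hf e0.
apply: (@interval_induction _ (fun a b =>
  finite_set [set t | a <= t <= b /\ e < enorm (left_val f t - f t)])).
  move=> a b c _ _ _ _ h1 h2.
  apply: (@sub_finite_set _ _ ([set t | a <= t <= b /\ e < enorm (left_val f t - f t)]
     `|` [set t | b <= t <= c /\ e < enorm (left_val f t - f t)])).
    move=> t [/andP[at_ tc] jt]; have [tb|/ltW bt] := leP t b.
      by left; split=> //; rewrite at_.
    by right; split=> //; rewrite bt.
  by rewrite finite_setU.
move=> t tI; have e2 : 0 < e / 2 by rewrite divr_gt0.
have [del del0 cl] := cadlag_clustered hf tI e2.
exists del => // a b a0 ab b1 ha hb _ _.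
apply: (@sub_finite_set _ _ [set t]); last exact: finite_set1.
move=> s [/andP[as_ sb] js] /=.
have s01 : 0 <= s <= 1 by rewrite (le_trans a0 as_) (le_trans sb b1).
have sw : t - del < s < t + del by rewrite (lt_le_trans ha as_) (le_lt_trans sb hb).
have [hl hr _] := cl _ _ (graph_complete (graph_left f s01)) sw.
have [hl' hr' _] := cl _ _ (graph_complete (graph_val f s01)) sw.
have far c : enorm (left_val f s - c) <= e / 2 -> enorm (f s - c) <= e / 2 -> s = t.
  move=> h1 h2; have tr := enorm_triangle c (left_val f s) (f s).
  by rewrite enormB in h2; clear -h1 h2 tr js; lra.
have [st|ts|//] := ltgtP s t; first exact: far (hl st) (hl' st).
exact: far (hr ts) (hr' ts).
Qed.

Lemma countable_jump_times f : cadlag01 f -> countable (jump_times f).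
Proof.
move=> hf.
apply: (@sub_countable _ _ _ (\bigcup_(k : nat)
   [set t | 0 <= t <= 1 /\ k.+1%:R^-1 < enorm (left_val f t - f t)])).
  apply: subset_card_le => t [tI jt].
  have j0 : 0 < enorm (left_val f t - f t).
    rewrite lt_neqAle enorm_ge0 andbT; apply/eqP => /esym/enorm0_eq0/eqP.
    by rewrite subr_eq0 => /eqP.
  have [N _ hN] := near_infty_natSinv_lt (PosNum j0).
  by exists N => //; split=> //; apply: hN => /=.
apply: bigcup_countable; first exact: countableP.
move=> k _; apply/finite_set_countable/finite_large_jumps => //.
Qed.

Lemma jump_times_interior f t : cadlag01 f -> jump_times f t -> 0 < t < 1.
Proof.
move=> hf [/andP[t0 t1] jt]; rewrite !lt_neqAle t0 t1 !andbT.
by apply/andP; split; apply/eqP => tE; apply: jt;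
  [rewrite -tE left_val0|rewrite tE left_val1].
Qed.

(** The distribution function of a finite measure charging every point of
    the countable set [J]. *)
Lemma jump_function J : countable J -> exists S,
  (forall s t, s <= t -> S s <= S t) /\
  (forall t, J t -> exists2 w, 0 < w & forall s, s < t -> S s + w <= S t).
Proof.
move=> /countable_injP[i inj].
pose v (t : R) (n : nat) : R :=
  if `[< exists x, [/\ J x, i x = n & x <= t] >] then geometric 1 (1 / 2) n else 0.
have g0 n : 0 < geometric 1 (1 / 2 : R) n by rewrite /geometric/= mul1r exprn_gt0.
have v0 t n : 0 <= v t n by rewrite /v; case: ifP => // _; exact: ltW.
have vg t n : v t n <= geometric 1 (1 / 2) n.
  by rewrite /v; case: ifP => // _; exact: ltW.
have vmono s t n : s <= t -> v s n <= v t n.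
  move=> st; rewrite {1}/v; case: ifPn => [/asboolP[x [Jx ix xs]]|_]; last exact: v0.
  by rewrite /v ifT//; apply/asboolP; exists x; rewrite (le_trans xs).
have vc t : cvgn (series (v t)).
  apply: (@series_le_cvg _ _ (geometric 1 (1 / 2))) => //.
    by move=> n; exact: ltW.
  by apply: is_cvg_geometric_series; rewrite ger0_norm ?divr_ge0// ltr_pdivrMr// mul1r ltr1n.
exists (fun t => limn (series (v t))); split.
  by move=> s t st; apply: lim_series_le => // n; exact: vmono.
move=> t Jt; exists (geometric 1 (1 / 2) (i t)) => // s st.
have vjump k : v s k + (if k == i t then geometric 1 (1 / 2) (i t) else 0) <= v t k.
  case: eqP => [->|_]; last by rewrite addr0 vmono// ltW.
  have -> : v s (i t) = 0.
    rewrite /v ifF//; apply/asboolP => -[x [Jx ix xs]].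
    have xt : x = t by apply: inj => //; exact: mem_set.
    by move: xs; rewrite xt leNgt st.
  by rewrite add0r /v ifT//; apply/asboolP; exists t.
set w := geometric 1 (1 / 2) (i t) in vjump *.
have -> : limn (series (v s)) + w = limn (fun n => series (v s) n + w).
  apply/esym/(cvg_lim (@Rhausdorff R)).
  by apply: cvgD; [exact: vc|exact: cvg_cst].
apply: ler_lim; [by apply: is_cvgD; [exact: vc|exact: is_cvg_cst]|exact: vc|].
exists (i t).+1 => // n /= itn.
have -> : w = \sum_(0 <= k < n) (if k == i t then w else 0).
  rewrite big_mkord (bigD1 (Ordinal itn))//= eqxx big1 ?addr0// => k.
  by rewrite -val_eqE/= => /negPf ->.
by rewrite /series -big_split; apply: ler_sum => k _; exact: vjump.
Qed.

(** A continuous non-decreasing map of the unit interval onto itself that is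
    constant on a nondegenerate interval above each point of [J]. *)
Definition resting_clock J r : Prop :=
  [/\ forall s s', 0 <= s -> s <= s' -> s' <= 1 -> r s <= r s',
      forall s, 0 <= s <= 1 -> 0 <= r s <= 1,
      forall t, 0 <= t <= 1 -> exists2 s, 0 <= s <= 1 & r s = t,
      exists2 L, 0 < L & forall s s', 0 <= s -> s <= s' -> s' <= 1 ->
        r s' - r s <= L * (s' - s) &
      forall t, J t -> exists s s', [/\ 0 <= s, s < s', s' <= 1, r s = t & r s' = t]].

(** The clock is the generalized inverse of [sigma t = t + S t], rescaled: the
    slope of [sigma] is at least 1, so its inverse is Lipschitz, and the jump of
    [sigma] at a point of [J] becomes an interval of rest. *)
Lemma resting_clock_exists J : countable J -> (forall t, J t -> 0 < t < 1) ->
  exists r, resting_clock J r.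
Proof.
move=> cJ JI; have [S [Smono Sjump]] := jump_function cJ.
pose sigma t := t + S t.
have sg s t : s <= t -> t - s <= sigma t - sigma s.
  by move=> /Smono; rewrite /sigma => h; clear -h; lra.
have sjump t : J t -> exists2 w, 0 < w & forall s, s < t -> sigma s + w <= sigma t.
  move=> /Sjump[w w0 h]; exists w => // s st; have := h s st.
  by rewrite /sigma => h'; clear -h' st; lra.
clearbody sigma; clear Smono Sjump S.
pose L := sigma 1 - sigma 0.
have L1 : 1 <= L by have := sg 0 1 ler01; rewrite subr0.
have L0 : 0 < L by exact: lt_le_trans L1.
pose D s := [set t | 0 <= t <= 1 /\ sigma t <= sigma 0 + s * L].
pose r s := sup (D s).
have D0 s : 0 <= s -> D s 0.
  by move=> s0; split; rewrite ?lexx ?ler01// lerDl mulr_ge0// ltW.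
have Dub s : has_ubound (D s) by exists 1 => t [/andP[]].
have Dr s t : D s t -> t <= r s by apply: ub_le_sup.
have rI s : 0 <= s -> 0 <= r s <= 1.
  move=> s0; rewrite (Dr _ _ (D0 _ s0))/=.
  by apply: ge_sup => [|t [/andP[]]//]; exists 0; exact: D0.
have rmono s s' : 0 <= s -> s <= s' -> r s <= r s'.
  move=> s0 ss'; apply: ge_sup => [|t [tI ts]]; first by exists 0; exact: D0.
  apply: Dr; split=> //; apply: (le_trans ts); rewrite lerD2l ler_wpM2r//.
  exact: ltW.
have rE s t : 0 <= s -> 0 <= t <= 1 -> sigma 0 + s * L <= sigma t ->
    (forall t', 0 <= t' -> t' < t -> sigma t' <= sigma 0 + s * L) -> r s = t.
  move=> s0 /andP[t0 t1] st h; apply/eqP; rewrite eq_le; apply/andP; split.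
    apply: ge_sup => [|t' [_ ts]]; first by exists 0; exact: D0.
    rewrite leNgt; apply/negP => tt'; have := sg _ _ (ltW tt').
    by clear -tt' ts st; lra.
  rewrite leNgt; apply/negP => rst; have /andP[r0 _] := rI s s0.
  have : D s ((r s + t) / 2).
    by split; [clear -r0 rst t0 t1|apply: h; clear -r0 rst t0 t1];
      [apply/andP; split| |]; lra.
  by move=> /Dr; clear -rst; lra.
have unit_time t : 0 <= t <= 1 ->
    0 <= (sigma t - sigma 0) / L <= 1 /\ sigma 0 + (sigma t - sigma 0) / L * L = sigma t.
  move=> /andP[t0 t1]; rewrite divfK ?gt_eqF// subrKC; split=> //.
  rewrite divr_ge0 ?(ltW L0)//=; last by have := sg _ _ t0; clear -t0; lra.
  by rewrite ler_pdivrMr// mul1r /L; have := sg _ _ t1; clear -t1; lra.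
exists r; split.
- by move=> s s' s0 ss' _; exact: rmono.
- by move=> s /andP[s0 _]; exact: rI.
- move=> t tI; have [sI sE] := unit_time t tI.
  exists ((sigma t - sigma 0) / L) => //; apply: rE => //; rewrite ?sE//.
    by case/andP: sI.
  by move=> t' _ tt'; have := sg _ _ (ltW tt'); clear -tt'; lra.
- exists L => // s s' s0 ss' s1; rewrite lerBlDr.
  have rs := rI s s0; have /andP[rs0 rs1] := rs.
  have LL : 0 <= L * (s' - s) by apply: mulr_ge0; [exact: ltW|rewrite subr_ge0].
  apply: ge_sup => [|t [/andP[t0 t1] ts]].
    by exists 0; apply: D0; exact: le_trans ss'.
  rewrite leNgt; apply/negP => tbig.
  have rt : r s < t by clear -LL tbig; lra.
  have [h|h] := leP t (r s); first by move: rt; rewrite ltNge h.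
  (* [t''] is beyond the supremum [r s] of [D s], but so far below [t] that the
     slope of [sigma] puts it in [D s] *)
  pose t'' := (r s + (t - L * (s' - s))) / 2.
  have rt'' : r s < t'' by rewrite /t''; clear -tbig; lra.
  have tt'' : t'' < t - L * (s' - s) by rewrite /t''; clear -tbig; lra.
  have : ~ D s t'' by move=> /Dr; rewrite leNgt rt''.
  apply; split; first by clear -rt'' tt'' rs0 t1 LL; apply/andP; split; lra.
  have ht : t'' <= t by clear -tt'' LL; lra.
  by have := sg _ _ ht; clear -tt'' ts; lra.
- move=> t Jt; have /andP[t0 t1] := JI t Jt; have [w w0 hw] := sjump t Jt.
  have tI : 0 <= t <= 1 by rewrite !ltW.
  have [/andP[s0 s1] sE] := unit_time t tI.
  pose s := (sigma t - w - sigma 0) / L.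
  have sE' : sigma 0 + s * L = sigma t - w by rewrite /s divfK ?gt_eqF// subrKC.
  have ss' : s < (sigma t - sigma 0) / L by rewrite ltr_pM2r ?invr_gt0//; clear -w0; lra.
  have s'0 : 0 <= s.
    by rewrite divr_ge0 ?(ltW L0)//; have := hw 0 t0; clear; lra.
  exists s, ((sigma t - sigma 0) / L); split=> //.
    apply: rE => //; first by rewrite sE'; clear -w0; lra.
    by move=> t' _ tt'; rewrite sE'; have := hw _ tt'; clear; lra.
  apply: rE => //; first by rewrite sE.
  by move=> t' _ tt'; rewrite sE; have := hw _ tt'; clear -w0; lra.
Qed.

End JumpTimes.

(** * Parametrization of complete graphs *)


Section Parametrization.
Context {R : realType} {d : nat}.
Implicit Types (f g : R -> 'rV[R]_d) (r l : R -> R) (J : set R).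
Implicit Types (a b s t w e : R).

Lemma within_I01P t (P : R -> Prop) : (\forall s \near within I01 (nbhs t), P s) <->
  exists2 del, 0 < del & forall s, 0 <= s <= 1 -> t - del < s < t + del -> P s.
Proof.
split=> [/nbhs_ballP[del /= del0 h]|[del del0 h]].
  exists del => // s sI st; apply: h; last by rewrite I01E.
  by rewrite /ball/= ltr_distlC.
apply/nbhs_ballP; exists del => //= s; rewrite /ball/= ltr_distlC => st.
by rewrite I01E => sI; exact: h.
Qed.

Definition rest_start r t : R := inf [set s | 0 <= s <= 1 /\ r s = t].
Definition rest_end r t : R := sup [set s | 0 <= s <= 1 /\ r s = t].

(** The set of instants at which the clock shows [t] is closed, by the Lipschitz
    condition, and convex, by monotonicity. *)
Lemma rest_intervalP J r t : resting_clock J r -> 0 <= t <= 1 ->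
  [/\ 0 <= rest_start r t, rest_start r t <= rest_end r t, rest_end r t <= 1 &
      forall s, 0 <= s <= 1 -> r s = t <-> rest_start r t <= s <= rest_end r t].
Proof.
move=> [rmono rI rsur [L L0 rlip] _] tI.
set E := [set s | 0 <= s <= 1 /\ r s = t].
have [s0 s0I rs0] := rsur t tI.
have Es0 : E s0 by [].
have Einf : has_inf E by split; [exists s0|exists 0 => s [/andP[]]].
have Esup : has_sup E by split; [exists s0|exists 1 => s [/andP[]]].
have lb s : E s -> rest_start r t <= s by apply: ge_inf; case: Einf.
have ub s : E s -> s <= rest_end r t by apply: ub_le_sup; case: Esup.
have a0 : 0 <= rest_start r t by apply: lb_le_inf => [|s [/andP[]]//]; exists s0.
have b1 : rest_end r t <= 1 by apply: ge_sup => [|s [/andP[]]//]; exists s0.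
have as0 := lb _ Es0; have s0b := ub _ Es0; have /andP[s00 s01] := s0I.
have ra : r (rest_start r t) = t.
  have := rmono _ _ a0 as0 s01; rewrite rs0 => ale.
  apply/eqP; rewrite eq_le ale/= leNgt; apply/negP => rat.
  have e0 : 0 < (t - r (rest_start r t)) / L by rewrite divr_gt0 ?subr_gt0.
  have [s Es] := inf_adherent e0 Einf; rewrite -ltrBlDl => sa.
  have [/andP[_ s1] rs] := Es.
  have := rlip _ _ a0 (lb _ Es) s1; rewrite rs leNgt => /negP; apply.
  by move: sa; rewrite ltr_pdivlMr// mulrC.
have rb : r (rest_end r t) = t.
  have := rmono _ _ s00 s0b b1; rewrite rs0 => leb.
  apply/eqP; rewrite eq_le leb andbT leNgt; apply/negP => rbt.
  have e0 : 0 < (r (rest_end r t) - t) / L by rewrite divr_gt0 ?subr_gt0.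
  have [s Es] := sup_adherent e0 Esup; rewrite ltrBlDr -ltrBlDl => sb.
  have [/andP[s0' _] rs] := Es.
  have := rlip _ _ s0' (ub _ Es) b1; rewrite rs leNgt => /negP; apply.
  by move: sb; rewrite ltr_pdivlMr// mulrC.
split=> //; first exact: le_trans s0b.
move=> s sI; split=> [rs|/andP[as_ sb]]; first by rewrite lb// ub.
have /andP[s0' s1] := sI.
have := rmono _ _ s0' sb b1; have := rmono _ _ a0 as_ s1; rewrite ra rb => h1 h2.
by apply/eqP; rewrite eq_le h2.
Qed.

(** Weight of the left value: it decreases linearly from 1 to 0 while the clock
    rests. At an instant where the clock does not rest the quotient is [0 / 0],
    hence 0. *)
Definition left_weight r s : R :=
  (rest_end r (r s) - s) / (rest_end r (r s) - rest_start r (r s)).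

(** The left limit and the value of [f] are joined at constant speed while the
    clock rests. *)
Definition sweep f r s : 'rV[R]_d :=
  left_weight r s *: left_val f (r s) + (1 - left_weight r s) *: f (r s).

Lemma left_weight_I01 J r s : resting_clock J r -> 0 <= s <= 1 ->
  0 <= left_weight r s <= 1.
Proof.
move=> hr sI; have [rmono rI _ _ _] := hr.
have [a0 ab b1 hs] := rest_intervalP hr (rI s sI).
have /andP[as_ sb] := (hs s sI).1 erefl.
rewrite /left_weight.
move: ab; rewrite le_eqVlt => /predU1P[->|ab].
  by rewrite subrr invr0 mulr0 lexx ler01.
apply/andP; split; first by rewrite divr_ge0 ?subr_ge0// ltW.
by rewrite ler_pdivrMr ?subr_gt0// mul1r lerD2l lerN2.
Qed.

Lemma left_weight_sub r s s' : r s = r s' ->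
  left_weight r s - left_weight r s' =
  (s' - s) / (rest_end r (r s) - rest_start r (r s)).
Proof.
move=> E; rewrite /left_weight -E -mulrBl; congr (_ * _).
ring.
Qed.

Lemma sweep_fiber f r s s' : r s = r s' ->
  sweep f r s - sweep f r s' =
  (left_weight r s - left_weight r s') *: (left_val f (r s) - f (r s)).
Proof.
move=> E; rewrite /sweep -E; set p := left_weight r s; set q := left_weight r s'.
set x := left_val _ _; set y := f _.
by apply/rowP => i; rewrite !mxE; ring.
Qed.

Lemma sweep_graph J f r s : resting_clock J r -> 0 <= s <= 1 ->
  complete_graph f (sweep f r s, r s).
Proof.
move=> hr sI; have [_ rI _ _ _] := hr; split; first by rewrite I01E; exact: rI.
by exists (left_weight r s) => //; rewrite I01E; exact: left_weight_I01 hr sI.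
Qed.

(** Either the clock starts a rest, and the weight of the left value is 1, or it
    does not rest, and [f] does not jump. *)
Lemma sweep_start J f r s : resting_clock J r -> jump_times f `<=` J ->
  0 <= s <= 1 -> s = rest_start r (r s) ->
  sweep f r s = left_val f (r s).
Proof.
move=> hr hJ sI sE; have [_ rI _ _ Jrest] := hr.
have [a0 ab b1 hs] := rest_intervalP hr (rI s sI).
have [bE|ab'] := eqVneq (rest_start r (r s)) (rest_end r (r s)).
  have nojump : left_val f (r s) = f (r s).
    apply: contrapT => jmp.
    have [|s1 [s2 [s10 s12 s21 rs1 rs2]]] := Jrest (r s).
      by apply: hJ; split=> //; exact: rI.
    have /andP[h1 _] := (hs s1 (ltac:(by rewrite s10 (le_trans (ltW s12))))).1 rs1.
    have /andP[_ h2] := (hs s2 (ltac:(by rewrite s21 (le_trans s10 (ltW s12))))).1 rs2.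
    by move: h2; rewrite -bE leNgt (le_lt_trans h1).
  by rewrite /sweep nojump convxx.
rewrite /sweep; have -> : left_weight r s = 1.
  rewrite /left_weight -sE divff//.
  by rewrite subr_eq0 eq_sym {1}sE.
by rewrite scale1r subrr scale0r addr0.
Qed.

Lemma sweep_end f r s : s = rest_end r (r s) ->
  sweep f r s = f (r s).
Proof.
move=> sE; rewrite /sweep; have -> : left_weight r s = 0.
  by rewrite /left_weight -sE subrr mul0r.
by rewrite scale0r add0r subr0 scale1r.
Qed.

(** Near [s], either the clock rests and [sweep] is affine, or it has just left
    [r s] on one side, where [f] is close to its one-sided limit at [r s]. *)
Lemma sweep_continuous J f r : cadlag01 f -> resting_clock J r ->
  jump_times f `<=` J -> {within I01, continuous (sweep f r)}.
Proof.
move=> hf hr hJ; apply/subspace_continuousP => s; rewrite I01E => sI.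
apply/cvg_enormP => e e0; apply/within_I01P.
have [rmono rI _ [L L0 rlip] _] := hr.
have e2 : 0 < e / 2 by rewrite divr_gt0.
have [del del0 cl] := cadlag_clustered hf (rI s sI) e2.
have [a0 ab b1 hs] := rest_intervalP hr (rI s sI).
have /andP[as_ sb] := (hs s sI).1 erefl.
set a := rest_start r (r s) in a0 ab hs as_ *.
set b := rest_end r (r s) in b1 ab hs sb *.
pose K := `|(b - a)^-1| * enorm (left_val f (r s) - f (r s)).
have K0 : 0 <= K by rewrite mulr_ge0 ?enorm_ge0.
pose d1 := if s < b then b - s else 1; pose d2 := if a < s then s - a else 1.
have d10 : 0 < d1 by rewrite /d1; case: ifPn => // sb'; rewrite subr_gt0.
have d20 : 0 < d2 by rewrite /d2; case: ifPn => // sa'; rewrite subr_gt0.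
have K1 : 0 < K + 1 by rewrite ltr_wpDl.
pose m := Num.min (Num.min d1 d2) (Num.min (del / L) (e / (K + 1))).
have m0 : 0 < m by rewrite !lt_min d10 d20 !divr_gt0.
have : m <= m by [].
rewrite {2}/m !le_min => /andP[/andP[m1 m2] /andP[m3 m4]].
exists m => // s' s'I /andP[ms sm].
change (enorm (sweep f r s' - sweep f r s) < e).
have /andP[s0 s1] := sI; have /andP[s'0 s'1] := s'I.
have Lm : L * m <= del by rewrite mulrC -ler_pdivlMr.
have out s1' s2' : s1' <= s2' -> s2' - s1' < m -> L * (s2' - s1') < del.
  by move=> _ h; apply: lt_le_trans Lm; rewrite ltr_pM2l.
have [lt_r|gt_r|eq_r] := ltgtP (r s') (r s).
- have ss : s' < s 
    by rewrite ltNge; apply/negP => /(rmono _ _ s0)/(_ s'1); rewrite leNgt lt_r.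
  have sa : s = a.
    apply/eqP; rewrite eq_le as_ andbT leNgt; apply/negP => as'.
    have as'' : a <= s' by move: m2; rewrite /d2 as' => m2; clear -m2 ms; lra.
    have := (hs s' s'I).2 (ltac:(by rewrite as'' (le_trans (ltW ss)))).
    by move=> E; move: lt_r; rewrite E ltxx.
  have [||hl _ _] := cl (sweep f r s') (r s').
  + exact: sweep_graph hr s'I.
  + have := rlip _ _ s'0 (ltW ss) s1; have := out _ _ (ltW ss).
    have ssm : s - s' < m by clear -ms; lra.
    move=> /(_ ssm) h1 h2; rewrite (lt_trans lt_r) ?ltrDl// andbT.
    by clear -h1 h2; lra.
  rewrite (sweep_start hr hJ sI)// (le_lt_trans (hl lt_r))//.
  by clear -e0; lra.
- have ss : s < s' 
    by rewrite ltNge; apply/negP => /(rmono _ _ s'0)/(_ s1); rewrite leNgt gt_r.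
  have bE : s = b.
    apply/eqP; rewrite eq_le sb /= leNgt; apply/negP => sb'.
    have bs' : s' <= b by move: m1; rewrite /d1 sb' => m1; clear -m1 sm; lra.
    have := (hs s' s'I).2 (ltac:(by rewrite bs' (le_trans as_ (ltW ss)))).
    by move=> E; move: gt_r; rewrite E ltxx.
  have [||_ hr' _] := cl (sweep f r s') (r s').
  + exact: sweep_graph hr s'I.
  + have := rlip _ _ s0 (ltW ss) s'1; have := out _ _ (ltW ss).
    have ssm : s' - s < m by clear -sm; lra.
    move=> /(_ ssm) h1 h2; rewrite (lt_trans _ gt_r) ?gtrBl//=.
    by clear -h1 h2; lra.
  rewrite (sweep_end f bE) (le_lt_trans (hr' gt_r))//.
  by clear -e0; lra.
- rewrite sweep_fiber// eq_r enormZ left_weight_sub// eq_r -/a -/b normrM -mulrA -/K.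
  have ssm : `|s - s'| < m by rewrite distrC ltr_distl; apply/andP.
  apply: (@le_lt_trans _ _ (`|s - s'| * (K + 1))); first by rewrite ler_wpM2l// lerDl.
  by rewrite -ltr_pdivlMr// (lt_le_trans ssm).
Qed.

Lemma clock_continuous J r : resting_clock J r -> {within I01, continuous r}.
Proof.
move=> [rmono rI _ [L L0 rlip] _].
apply/subspace_continuousP => s; rewrite I01E => /andP[s0 s1].
apply/cvgrPdist_lt => e e0; apply/within_I01P; exists (e / L); first by rewrite divr_gt0.
move=> s' /andP[s'0 s'1] /andP[h1 h2].
change (`|r s - r s'| < e); rewrite ltr_distl.
have eL : L * (e / L) = e by rewrite mulrC divfK// gt_eqF.
have [ss|/ltW ss] := leP s s'.
  have := rlip _ _ s0 ss s'1; have := rmono _ _ s0 ss s'1.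
  have : L * (s' - s) < L * (e / L) by rewrite ltr_pM2l//; clear -h2; lra.
  by rewrite eL => k1 k2 k3; clear -k1 k2 k3 e0; apply/andP; split; lra.
have := rlip _ _ s'0 ss s1; have := rmono _ _ s'0 ss s1.
have : L * (s - s') < L * (e / L) by rewrite ltr_pM2l//; clear -h1; lra.
by rewrite eL => k1 k2 k3; clear -k1 k2 k3 e0; apply/andP; split; lra.
Qed.

Lemma sweep_parametrization J f r : cadlag01 f -> resting_clock J r ->
  jump_times f `<=` J -> parametrization f (sweep f r) r.
Proof.
move=> hf hr hJ; have [rmono rI rsur _ Jrest] := hr; split.
- exact: sweep_continuous hf hr hJ.
- exact: clock_continuous hr.
- by move=> s; rewrite !I01E; exact: rI.
- move=> s s'; rewrite !I01E => sI s'I ss'.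
  have /andP[s0 s1] := sI; have /andP[s'0 s'1] := s'I.
  have := rmono _ _ s0 ss' s'1; rewrite le_eqVlt => /predU1P[E|]; last by left.
  right; split=> //=.
  have key q : 0 <= q <= 1 -> enorm (left_val f (r q) - sweep f r q) =
      (1 - left_weight r q) * enorm (left_val f (r q) - f (r q)).
    move=> qI; have /andP[_ w1] := left_weight_I01 hr qI.
    rewrite -[X in X * _]ger0_norm ?subr_ge0// -enormZ /sweep; congr enorm.
    by apply/rowP => i; rewrite !mxE; ring.
  rewrite !key// -E ler_wpM2r ?enorm_ge0// lerD2l lerN2 -subr_ge0.
  rewrite left_weight_sub//.
  have [_ ab _ _] := rest_intervalP hr (rI s sI).
  by rewrite divr_ge0// subr_ge0.
- apply/seteqP; split=> [_ [s sI <-]|[z t] [/=]].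
    by move: sI; rewrite I01E => sI; exact: (sweep_graph f hr sI).
  rewrite I01E => tI zt.
  have [a0 ab b1 hs] := rest_intervalP hr tI.
  set a := rest_start r t in a0 ab hs; set b := rest_end r t in ab b1 hs.
  case: zt => w; rewrite I01E => /andP[w0 w1] <-.
  pose s := b - w * (b - a).
  have h1 : 0 <= w * (b - a) by rewrite mulr_ge0// subr_ge0.
  have h2 : w * (b - a) <= b - a by rewrite ler_piMl// subr_ge0.
  have sab : a <= s <= b by rewrite /s; clear -h1 h2; apply/andP; split; lra.
  have sI : 0 <= s <= 1.
    by move: sab => /andP[k1 k2]; rewrite (le_trans a0 k1) (le_trans k2 b1).
  have rs : r s = t by apply/(hs s sI).
  exists s; first by rewrite I01E.
  rewrite rs; congr pair.
  move: ab; rewrite le_eqVlt => /predU1P[abE|ab].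
    have sE : s = rest_start r (r s).
      by rewrite rs -/a; move: sab; rewrite -abE -eq_le => /eqP.
    have sE' : s = rest_end r (r s) by rewrite rs -/b -abE {1}sE rs.
    have nojump : left_val f t = f t.
      by rewrite -rs -(sweep_start hr hJ sI sE) (sweep_end _ sE').
    by rewrite (sweep_end _ sE') rs nojump convxx.
  rewrite /sweep; have -> : left_weight r s = w; last by rewrite rs.
  by rewrite /left_weight rs -/a -/b /s subKr mulfK// gt_eqF// subr_gt0.
Qed.

Lemma parametrization_comp g u r l : cadlag01 g -> increasing_bijection l ->
  time_change l -> parametrization (g \o l) u r -> parametrization g u (l \o r).
Proof.
move=> hg hl [lc _] [uc rc rI mono im].
have lv := comp_left_val hg hl; have [inc _ _ lsur] := hl.
have rI' s : I01 s -> 0 <= r s <= 1 by move=> /rI; rewrite I01E.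
split; first exact: uc.
- move/subspace_continuousP : lc => lc; move/subspace_continuousP : rc => rc.
  apply/subspace_continuousP => s sI; apply/cvgrPdist_lt => e e0.
  move/cvgrPdist_lt : (lc _ (rI _ sI)) => /(_ e e0)/within_I01P[del del0 h].
  move/cvgrPdist_lt : (rc _ sI) => /(_ del del0)/within_I01P[k k0 hk].
  apply/within_I01P; exists k => // s' s'I ss'; apply: h.
    by apply: rI'; rewrite I01E.
  by have := hk s' s'I ss'; rewrite ltr_distlC.
- by move=> s sI; rewrite I01E; apply/(increasing_bijection_I01 hl)/rI'.
- move=> s s' sI s'I ss'; have /andP[r0 _] := rI' _ sI; have /andP[_ r1] := rI' _ s'I.
  case: (mono s s' sI s'I ss') => /= [rr|[rr h]]; first by left; apply: inc.
  move: h; rewrite (lv _ (rI' _ sI)) (lv _ (rI' _ s'I)) => h.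
  by right; split; [rewrite /= rr|exact: h].
- apply/seteqP; split=> [_ [s sI <-]|[z t] [/=]].
    have : complete_graph (g \o l) (u s, r s) by rewrite -im; exists s.
    move=> [/= _]; rewrite lv; last exact: rI'.
    move=> us; split=> //=; rewrite I01E.
    by apply/(increasing_bijection_I01 hl)/rI'.
  rewrite I01E => tI zt; have [q qI lq] := lsur t tI.
  have : complete_graph (g \o l) (z, q) by split; rewrite /= ?I01E// lv// lq.
  by rewrite -im => -[s sI [us rs]]; exists s => //=; rewrite us rs lq.
Qed.

(** A clock resting at the jump times of both [f] and [fn n \o l] parametrizes
    the two complete graphs with the same convex weights. *)
Lemma cvg_J1_M1 (fn : nat -> R -> 'rV[R]_d) f :
  (forall n, cadlag01 (fn n)) -> cadlag01 f -> cvg_for dJ1 fn f ->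
  cvg_for dM1 fn f.
Proof.
move=> hfn hf /cvg_J1P hJ; apply/cvg_M1P => e e0.
pose e' := Num.min e (1 / 3).
have e'0 : 0 < e' by rewrite lt_min e0 divr_gt0.
have [e'e e'1] : e' <= e /\ e' <= 1 / 3 by rewrite !ge_min !lexx orbT.
have := hJ e' e'0; apply: filterS => n [l lT h].
have e2 : e' < 1 / 2 by clear -e'1; lra.
have inc := time_change_increasing lT e2 (fun t tI => (h t tI).2).
have hc := comp_cadlag (hfn n) inc.
have hv t : 0 <= t <= 1 -> enorm ((fn n \o l) t - f t) <= e'.
  by rewrite -I01E => /h[].
have hL := left_val_close hc hf hv.
pose J := jump_times f `|` jump_times (fn n \o l).
have [|t|r hr] := @resting_clock_exists _ J.
- apply: (@sub_countable _ _ _ (\bigcup_(b : bool)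
    jump_times (if b then f else fn n \o l))).
    by apply: subset_card_le => t [jt|jt]; [exists true|exists false].
  apply: bigcup_countable; first exact: countableP.
  by case=> _; exact: countable_jump_times.
- by case; exact: jump_times_interior.
have [_ rI _ _ _] := hr.
exists (sweep (fn n \o l) r), (l \o r), (sweep f r), r; split.
- apply: parametrization_comp => //.
  by apply: (sweep_parametrization hc hr); right.
- by apply: (sweep_parametrization hf hr); left.
- move=> s; rewrite I01E => sI; have rsI := rI s sI; split.
    apply: enorm_conv; first exact: left_weight_I01 hr sI.
      exact: le_trans (hL _ rsI) e'e.
    exact: le_trans (hv _ rsI) e'e.
  by move: rsI; rewrite -I01E => /h[_ /le_trans]; exact.
Qed.

End Parametrization.

Theorem mainTheorem5 (R : realType) (d : nat)
    (fn : nat -> R -> 'rV[R]_d) (f : R -> 'rV[R]_d)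
    (hfn : forall n, cadlag01 (fn n)) (hf : cadlag01 f) :
  (cvg_for dJ1 fn f -> cvg_for dJ2 fn f) /\
  (cvg_for dJ1 fn f -> cvg_for dM1 fn f) /\
  (cvg_for dJ2 fn f -> cvg_for dM2 fn f) /\
  (cvg_for dM1 fn f -> cvg_for dM2 fn f) /\
  (cvg_for dJ1 fn f <-> cvg_for dM1 fn f /\ cvg_for dJ2 fn f).
Proof.
have J12 := cvg_J1_J2 hfn hf; have J1M1 := cvg_J1_M1 hfn hf.
split=> //; split=> //; split; first exact: cvg_J2_M2.
split; first exact: cvg_M1_M2.
split=> [h|[hM hJ]]; first by split; [exact: J1M1|exact: J12].
exact: cvg_M1_J2_J1.
Qed.
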